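(* Every minimally $1$-tough $(K_1\cup P_4)$-free graph on at least three vertices is hamiltonian.
   Context: All graphs are simple and finite. $P_n$ denotes the path on $n$ vertices, and $K_1$ is the one-vertex graph. $H_1\cup H_2$ denotes the union of two vertex-disjoint graphs $H_1$ and $H_2$ (with no edges between them), so $K_1\cup P_4$ is the disjoint union of an isolated vertex and a path on four vertices. A graph $G$ is $H$-free if it contains no induced subgraph isomorphic to $H$. A graph is hamiltonian if it has a cycle containing all its vertices. Let $\omega(G)$ denote the number of components of $G$. A vertex subset $S$ of $G$ is a vertex cut if $G-S$ is disconnected. For a real number $t\ge 0$, $G$ is $t$-tough if $|S|\ge t\cdot\omega(G-S)$ for every vertex cut $S$ of $G$. The toughness $\tau(G)$ is the maximum $t$ such that $G$ is $t$-tough if $G$ is non-complete, and $\tau(G)=+\infty$ if $G$ is complete. For a positive real number $t$, $G$ is minimally $t$-tough if $\tau(G)=t$ and $\tau(G-e)<t$ for each edge $e$ of $G$, where $G-e$ is $G$ with the edge $e$ deleted. *)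

(* Defs.v *)
From mathcomp Require Import all_boot all_order all_algebra.
From mathcomp Require Import classical_sets reals constructive_ereal.

Set Implicit Arguments.
Unset Strict Implicit.
Unset Printing Implicit Defensive.

Import Order.TTheory GRing.Theory Num.Theory.
Local Open Scope ring_scope.

Record sgraph := SGraph {
  vertex :> finType;
  adj : rel vertex;
  adj_sym : symmetric adj;
  adj_irrefl : irreflexive adj }.

Arguments adj {s} : rename.
Arguments SGraph {vertex}.

Lemma complete_graph_sym n : symmetric (fun i j : 'I_n => i != j).
Proof. by move=> i j; rewrite eq_sym. Qed.

Lemma complete_graph_irrefl n : irreflexive (fun i j : 'I_n => i != j).
Proof. by move=> i; rewrite eqxx. Qed.

Definition complete_graph (n : nat) : sgraph :=
  SGraph _ (@complete_graph_sym n) (@complete_graph_irrefl n).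

Definition path_adj n (i j : 'I_n) : bool :=
  (i.+1 == j :> nat) || (j.+1 == i :> nat).

Lemma path_adj_sym n : symmetric (@path_adj n).
Proof. by move=> i j; rewrite /path_adj orbC. Qed.

Lemma path_adj_irrefl n : irreflexive (@path_adj n).
Proof. by move=> i; rewrite /path_adj orbb gtn_eqF. Qed.

Definition path_graph (n : nat) : sgraph :=
  SGraph _ (@path_adj_sym n) (@path_adj_irrefl n).

Definition union_adj (G H : sgraph) (u v : G + H) : bool :=
  match u, v with
  | inl x, inl y => adj x y
  | inr x, inr y => adj x y
  | _, _ => false
  end.

Lemma union_adj_sym G H : symmetric (@union_adj G H).
Proof. by move=> [x|x] [y|y] //=; rewrite adj_sym. Qed.

Lemma union_adj_irrefl G H : irreflexive (@union_adj G H).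
Proof. by move=> [x|x] /=; rewrite adj_irrefl. Qed.

Definition disjoint_union (G H : sgraph) : sgraph :=
  SGraph _ (@union_adj_sym G H) (@union_adj_irrefl G H).

Definition del_vertices_adj (G : sgraph) (S : {set G})
  (u v : {x : G | x \notin S}) : bool := adj (val u) (val v).

Lemma del_vertices_adj_sym G S : symmetric (@del_vertices_adj G S).
Proof. by move=> u v; rewrite /del_vertices_adj adj_sym. Qed.

Lemma del_vertices_adj_irrefl G S : irreflexive (@del_vertices_adj G S).
Proof. by move=> u; rewrite /del_vertices_adj adj_irrefl. Qed.

Definition del_vertices (G : sgraph) (S : {set G}) : sgraph :=
  SGraph _ (@del_vertices_adj_sym G S) (@del_vertices_adj_irrefl G S).

Definition edges (G : sgraph) : {set {set G}} :=
  [set [set p.1; p.2] | p : G * G & adj p.1 p.2].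

Definition del_edge_adj (G : sgraph) (e : {set G}) (u v : G) : bool :=
  adj u v && ([set u; v] != e).

Lemma del_edge_adj_sym G e : symmetric (@del_edge_adj G e).
Proof. by move=> u v; rewrite /del_edge_adj adj_sym finset.setUC. Qed.

Lemma del_edge_adj_irrefl G e : irreflexive (@del_edge_adj G e).
Proof. by move=> u; rewrite /del_edge_adj adj_irrefl. Qed.

Definition del_edge (G : sgraph) (e : {set G}) : sgraph :=
  SGraph _ (@del_edge_adj_sym G e) (@del_edge_adj_irrefl G e).

Definition is_complete (G : sgraph) : bool :=
  [forall x : G, forall y : G, (x != y) ==> adj x y].

Definition connected (G : sgraph) : bool :=
  [forall x : G, forall y : G, connect adj x y].

Definition num_components (G : sgraph) : nat := n_comp adj [set: G].

(* The graph without vertices counts as connected, so [set: G] is not a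
   vertex cut. *)
Definition vertex_cut (G : sgraph) (S : {set G}) : bool :=
  ~~ connected (del_vertices S).

Definition H_free (H G : sgraph) : Prop :=
  ~ exists f : H -> G, injective f /\ forall x y, adj (f x) (f y) = adj x y.

Definition hamiltonian (G : sgraph) : Prop :=
  exists c : seq G, [/\ (3 <= size c)%N, ucycle adj c & forall x, x \in c].

Section Toughness.
Context {R : realType}.

Definition tough (t : R) (G : sgraph) : Prop :=
  forall S : {set G}, vertex_cut S ->
    t * (num_components (del_vertices S))%:R <= #|S|%:R.

(* The supremum is a maximum, by toughness_max below. *)
Definition toughness (G : sgraph) : \bar R :=
  if is_complete G then +oo%E
  else (sup [set t : R | 0 <= t /\ tough t G]%classic)%:E.

Definition minimally_tough (t : R) (G : sgraph) : Prop :=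
  [/\ 0 < t, toughness G = t%:E
    & forall e : {set G}, e \in edges G -> (toughness (del_edge e) < t%:E)%E].

Lemma vertex_cut_num_components (G : sgraph) (S : {set G}) :
  vertex_cut S -> (0 < num_components (del_vertices S))%N.
Proof.
case/forallPn => x _; apply/card_gt0P; exists (fingraph.root adj x).
by rewrite !inE roots_root //; apply: sym_connect_sym; apply: adj_sym.
Qed.

Lemma noncomplete_vertex_cut (G : sgraph) :
  ~~ is_complete G -> exists S : {set G}, vertex_cut S.
Proof.
case/forallPn => x /forallPn[y]; rewrite negb_imply => /andP[xy nadj].
pose S := ~: [set x; y].
have xS : x \notin S by rewrite !inE eqxx.
have yS : y \notin S by rewrite !inE eqxx orbT.
exists S; apply/forallPn; exists (Sub x xS).
apply/forallPn; exists (Sub y yS); apply/negP => /connectP[[|z p] /=].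
  by move=> _ /(congr1 val) /= yx; rewrite yx eqxx in xy.
case/andP => xz _ _; have := valP z; rewrite !inE negbK.
move: xz; rewrite /del_vertices_adj /= => xz /orP[]/eqP zE.
  by rewrite zE adj_irrefl in xz.
by rewrite zE (negbTE nadj) in xz.
Qed.

Lemma toughness_max (G : sgraph) (tau : R) :
  ~~ is_complete G ->
  toughness G = tau%:E <->
  [/\ 0 <= tau, tough tau G
    & forall t : R, 0 <= t -> tough t G -> t <= tau].
Proof.
move=> ncG; rewrite /toughness (negbTE ncG).
set E := [set t : R | _]%classic.
have [S0 cut0] := noncomplete_vertex_cut ncG.
have E0 : E 0 by split=> // S _; rewrite mul0r ler0n.
have bnd (S : {set G}) : vertex_cut S ->
    ubound E (#|S|%:R / (num_components (del_vertices S))%:R).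
  move=> cutS t [_ /(_ S cutS)]; rewrite ler_pdivlMr //.
  by rewrite ltr0n vertex_cut_num_components.
have ubE : has_ubound E by eexists; exact: bnd cut0.
have supub t : E t -> t <= sup E by move=> Et; apply: ub_le_sup.
have supE : E (sup E).
  split; first exact: supub.
  move=> S cutS; rewrite -ler_pdivlMr ?ltr0n ?vertex_cut_num_components //.
  by apply: ge_sup; [exists 0 | apply: bnd].
split=> [[<-]|[tau0 tgh maxtau]].
  by case: (supE) => s0 ts; split=> // t t0 tt; apply: supub.
congr EFin; apply/eqP; rewrite eq_le supub ?andbT //.
by case: supE => s0 ts; apply: maxtau.
Qed.

End Toughness.

(* Main.v *)
Require Import Defs.
From mathcomp Require Import all_boot all_order all_algebra.
From mathcomp Require Import classical_sets reals constructive_ereal.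
From mathcomp Require Import boolp zify.
From mathcomp Require Import fintype finset path.

Set Implicit Arguments.
Unset Strict Implicit.
Unset Printing Implicit Defensive.

(** Why the theorem holds. Minimality gives every edge [uv] a critical set
[T]: the edge is a bridge of [G - T], and [G - T] has as many components as
[T] has vertices. Forbidding [K1 + P4] makes every component of a disconnected
[G - T] a graph without induced [P4], hence a single vertex or a join of two
smaller graphs ([cograph_split]). All components are handled through colourings
that are constant along the edges of [G - T], so that 1-toughness reads: a
colouring off [S] with at least two colours has at most [#|S|] of them.

A first consequence ([private_nbr]) is that for adjacent [u] and [v] the closed
neighbourhood of [u] never contains that of [v]: if it did, [v] would lie in
the critical set of an edge [us], with [s] a neighbour of [v], without joining
two components, and moving [v] out of that set would violate 1-toughness.

Suppose that [{a, b}] is a cut and let [C] be one of its two sides. Then [C] is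
covered by a path from a neighbour of [a] to a neighbour of [b]
([ham_path_two_cut]); the paths of the two sides together with [a] and [b] form
a Hamilton cycle ([hamiltonian_two_cut]). To find the path, write the connected
[P4]-free set [C] as a join. A critical set of an edge between the two factors
has at most two vertices in [C] together with [a] and [b], and if it meets [C]
then, unless it is a single vertex,
  it contains all neighbours in [C] of [a] or [b]
([critical_two_cut]). If both factors have at least two vertices and one has at
least three, no choice of attachments is compatible with this for all edges
between the factors ([join_large_absurd]); two factors of two vertices are
explicit. Otherwise one factor is a single vertex [u], and the rest of [C] turns
out to be at most two disjoint copies of [K1] or [K2], so that the path can run
through [u].

Suppose that there is no cut with at most two vertices. For every edge, critical
sets then have at least three vertices and [K1 + P4]-freeness forces a pendant
shape ([pendant]): one end [v] of the edge is a leaf of its component, and the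
other end [u] is adjacent to that whole component [M]. Any vertex of the
critical set [S] that sees exactly one of [u] and [v] is adjacent to everything
outside [S] and [M] ([pendant_complete]). Let [x] be a neighbour of [v] that is
not one of [u]. The pendant shape of the edge [xv] can only be one in which [v]
is again the leaf; counting components shows that [v] has exactly one more
  neighbour [z] in [S],
and that some set [P] inside [M], larger than its complement [Q] there, is
completely joined to [z] and not at all to [x] ([private_nbr_swap]). Exchanging
[x] and [z] gives such sets with [x] and [z] swapped; each [P] lies in the other
[Q], which is impossible by cardinality ([no_pendant]). *)

(** * Graphs without induced P4 *)

Section Cographs.
Variable V : finType.
Implicit Types (e r : rel V) (A B C : {set V}).

(** The relation [r] is meant to be non-adjacency (a disconnected set) or
adjacency (a join); using one notion for both lets the proof of [cograph_split]
pass to the complement graph. *)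
Definition split_by r C A :=
  [/\ A \subset C, A != set0, C :\: A != set0
    & forall x y, x \in A -> y \in C :\: A -> r x y].

Definition P4_free e C := forall a b c d,
  a \in C -> b \in C -> c \in C -> d \in C -> e a b -> e b c -> e c d ->
  ~~ e a c -> ~~ e a d -> ~~ e b d -> False.

Definition anti e : rel V := fun x y => ~~ e x y.
Definition coadj e : rel V := fun x y => (x != y) && ~~ e x y.

Lemma split_sym r C A : symmetric r -> split_by r C A -> split_by r C (C :\: A).
Proof.
move=> rS [AC A0 CA rA].
have CCA : C :\: (C :\: A) = A by rewrite setDDr setDv set0U; apply/setIidPr.
by split; rewrite ?CCA ?subsetDl // => x y xA yA; rewrite rS rA.
Qed.

Lemma split_ext r r' C A :
  (forall x y, x \in A -> y \in C :\: A -> r x y -> r' x y) ->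
  split_by r C A -> split_by r' C A.
Proof. by move=> rr' [AC A0 CA rA]; split=> // x y xA yA;
  apply: rr' (rA _ _ _ _). Qed.

(** The set [C - x] is disconnected, with [A] a union of components. If no edge
of [A] joins a neighbour of [x] to a non-neighbour, the non-neighbours in [A]
are separated from the rest of [C]. Otherwise such an edge [y1 y2], together
with [x] and a neighbour of [x] outside [A], would be an induced path on four
vertices, so [x] has no neighbour outside [A]. *)
Lemma split_extend_near e C A x y :
  symmetric e -> P4_free e C -> x \in C -> split_by (anti e) (C :\ x) A ->
  y \in A -> ~~ e x y -> exists A', split_by (anti e) C A'.
Proof.
move=> eS P4C xC [AC A0 CA nA] yA nxy.
have xA : x \notin A by apply/negP => /(subsetP AC); rewrite !inE eqxx.
have AC' z : z \in A -> z \in C by move/(subsetP AC); rewrite !inE => /andP[].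
pose M := [set z in A | ~~ e x z].
have [/existsP[y1 /andP[/andP[y1A xy1] /existsP[y2 /andP[y2M y12]]]]|nN] :=
  boolP [exists y1, (y1 \in A) && e x y1 && [exists y2, (y2 \in M) && e y1 y2]].
- exists ((C :\ x) :\: A); split=> //.
  + by apply/subsetP => z; rewrite !inE => /and3P[].
  + by apply/set0Pn; exists x; rewrite !inE eqxx xC andbF.
  + move=> z w zB; rewrite !inE negb_and negbK => /andP[wBx wC].
    have zA : z \notin A by move: zB; rewrite inE => /andP[].
    have zC : z \in C by move: zB; rewrite !inE => /and3P[].
    have [wx|wx] := eqVneq w x; last first.
      rewrite wx wC /= orbF in wBx.
      by rewrite /anti eS; apply: nA.
    apply/negP; rewrite wx => zx; move: y2M; rewrite inE => /andP[y2A nxy2].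
    by apply: (P4C z x y1 y2 zC xC (AC' _ y1A) (AC' _ y2A)) => //;
      rewrite eS; apply: nA.
- exists M; split.
  + by apply/subsetP => z; rewrite inE => /andP[/AC'].
  + by apply/set0Pn; exists y; rewrite inE yA.
  + by apply/set0Pn; exists x; rewrite !inE xC (negbTE xA).
  + move=> z w zM; rewrite inE => /andP[wM wC].
    have [zA nxz] : z \in A /\ ~~ e x z by move: zM; rewrite inE => /andP[].
    have [wx|wx] := eqVneq w x; first by rewrite /anti eS wx.
    have [wA|wA] := boolP (w \in A); last by apply: nA; rewrite ?inE ?wA ?wx.
    have xw : e x w by move: wM; rewrite inE wA negbK.
    apply: contra nN => zw; apply/existsP; exists w; rewrite wA xw /=.
    by apply/existsP; exists z; rewrite zM eS.
Qed.

Lemma split_extend e C A x :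
  symmetric e -> P4_free e C -> x \in C -> split_by (anti e) (C :\ x) A ->
  exists A', split_by (anti e) C A' \/ split_by e C A'.
Proof.
move=> eS P4C xC spA; have aS : symmetric (anti e) by move=> y z;
  rewrite /anti eS.
have [/forallP cx|/forallPn[y]] := boolP [forall y, (y \in C :\ x) ==> e x y].
  exists [set x]; right; split.
  - by rewrite sub1set.
  - by apply/set0Pn; exists x; rewrite inE.
  - have [AC /set0Pn[z zA] _ _] := spA; apply/set0Pn; exists z.
    exact: (subsetP AC).
  - by move=> _ y /set1P-> yC; apply: (implyP (cx y)).
rewrite negb_imply => /andP[yC nxy].
have [yA|yA] := boolP (y \in A).
  by have [A' ?] := split_extend_near eS P4C xC spA yA nxy; exists A'; left.
have yA' : y \in (C :\ x) :\: A by rewrite inE yA.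
have [A' ?] := split_extend_near eS P4C xC (split_sym aS spA) yA' nxy.
by exists A'; left.
Qed.

(** Seinsche's theorem. The induction removes a vertex; since [P4] is its own
complement, the case where the smaller set is a join reduces to the
disconnected case in the complement graph [coadj e]. *)
Lemma cograph_split e C : symmetric e -> irreflexive e -> P4_free e C ->
  1 < #|C| -> exists A, split_by (anti e) C A \/ split_by e C A.
Proof.
move=> + + + C1; have [n] := ubnP #|C|; elim: n => // n IHn in C C1 e *.
rewrite ltnS => Cn eS eI P4C.
have /card_gt0P[x xC] : 0 < #|C| by apply: leq_trans C1.
have Cx : #|C| = #|C :\ x|.+1 by rewrite (cardsD1 x C) xC.
have P4Cx r : P4_free r C -> P4_free r (C :\ x).
  move=> P4 a b c d; rewrite !inE => /andP[_ aC] /andP[_ bC] /andP[_ cC].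
  by case/andP=> _; apply: P4.
(* two vertices: either kind of split is available *)
have [C2|C2] := leqP #|C :\ x| 1.
  have /cards1P[y yE] : #|C :\ x| == 1 by rewrite eqn_leq C2 -ltnS -Cx.
  have /andP[yx yC] : (y != x) && (y \in C) by rewrite -in_setD1 yE set11.
  have sp r : r x y -> split_by r C [set x].
    move=> rxy; split; rewrite ?sub1set ?yE -?card_gt0 ?cards1 //.
    by move=> _ _ /set1P-> /set1P->.
  exists [set x]; case exy : (e x y); [right|left]; apply: sp => //.
  by rewrite /anti exy.
have [|A [spA|spA]] := IHn (C :\ x) C2 e _ eS eI (P4Cx e P4C).
- by rewrite -ltnS -Cx.
- exact: split_extend spA.
have cS : symmetric (coadj e) by move=> y z; rewrite /coadj eq_sym eS.
have cP4 : P4_free (coadj e) C.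
  move=> a b c d aC bC cC dC /andP[ab nab] /andP[bc nbc] /andP[cd ncd].
  rewrite !negb_and !negbK => ac ad bd.
  case/orP: ac => [/eqP acE|ac]; last case/orP: ad => [/eqP adE|ad].
  - by case/orP: ad => [/eqP adE|];
      [rewrite -acE adE eqxx in cd | rewrite acE; apply/negP].
  - by case/orP: bd => [/eqP bdE|];
      [rewrite bdE adE eqxx in ab | rewrite -adE eS; apply/negP].
  case/orP: bd => [/eqP bdE|bd]; first by case/negP: nab; rewrite bdE.
  by apply: (P4C b d a c); rewrite // eS.
have cnA r (A' : {set V}) :
  split_by r (C :\ x) A' -> {in A' & (C :\ x) :\: A', forall y z, y != z}.
  by move=> _ y z yA; rewrite inE => /andP[zA _]; apply: contraNneq zA => <-.
have [A' [spA'|spA']] : exists A',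
  split_by (anti (coadj e)) C A' \/ split_by (coadj e) C A'.
  apply: split_extend cP4 xC (split_ext _ spA) => // y z yA zA eyz.
  by rewrite /anti /coadj (cnA _ _ spA) //= eyz.
- exists A'; right; apply: split_ext spA' => y z yA; rewrite inE => /andP[zA _].
  by rewrite /anti /coadj negb_and !negbK; case/orP=> // /eqP yz;
    rewrite -yz yA in zA.
- by exists A'; left; apply: split_ext spA' => y z _ _ /andP[].
Qed.
End Cographs.

(** * Components as colourings *)

(** Such an [f] is a colouring of [G - S] that is constant on components.
Counting colours replaces counting components and avoids the subtype of
remaining vertices. *)
Definition locally_const (G : sgraph) (K : eqType) (S : {set G}) (f : G -> K) :=
  forall x y, x \notin S -> y \notin S -> adj x y -> f x = f y.

Definition one_tough (G : sgraph) :=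
  forall (K : finType) (S : {set G}) (f : G -> K), locally_const S f ->
  1 < #|f @: ~: S| -> #|f @: ~: S| <= #|S|.

(** The set [T] and colouring [f] witness that [G - uv] is not 1-tough. In [G]
only the colours of [u] and [v] are identified, so [G - T] itself has at least
[#|T|] components. *)
Record critical_cut (G : sgraph) (u v : G) (T : {set G}) (f : G -> G) : Prop :=
  CriticalCut {
  crit_uT : u \notin T;
  crit_vT : v \notin T;
  crit_uv : f u != f v;
  crit_lc : forall x y, x \notin T -> y \notin T -> adj x y ->
    ~~ ((x == u) && (y == v) || (x == v) && (y == u)) -> f x = f y;
  crit_card : #|T| < #|f @: ~: T| }.

Section Colorings.
Context {G : sgraph}.
Implicit Types (u v w x y z : G) (S T : {set G}).

Lemma adjC x y : adj x y = adj y x.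
Proof. exact: adj_sym. Qed.

Lemma adj_neq x y : adj x y -> x != y.
Proof. by apply: contraTneq => ->; rewrite adj_irrefl. Qed.

Lemma leq_colors (K L : finType) (A : {set G}) (f : G -> K) (g : G -> L) :
  {in A &, forall x y, g x = g y -> f x = f y} -> #|f @: A| <= #|g @: A|.
Proof.
move=> gf; pose h (l : L) := [pick x in A | g x == l].
pose k l := if h l is Some x then Some (f x) else None.
have Sinj : injective (@Some K) by move=> ? ? [].
rewrite -(card_imset _ Sinj).
apply: leq_trans (leq_imset_card k (mem (g @: A))).
apply/subset_leq_card/subsetP => _ /imsetP[_ /imsetP[x xA ->] ->].
apply/imsetP; exists (g x); first exact: imset_f.
rewrite /k /h; case: pickP => [y /andP[yA /eqP gyx]|/(_ x)].
  by rewrite (gf y x).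
by rewrite xA eqxx.
Qed.

(** This is how lower bounds on numbers of components are assembled from the
disjoint palettes of several parts. *)
Lemma leq_colorsU (K : finType) (X Y Z : {set G}) (f : G -> K) :
  Y \subset X -> Z \subset X -> {in Y & Z, forall y z, f y != f z} ->
  #|f @: Y| + #|f @: Z| <= #|f @: X|.
Proof.
move=> YX ZX nYZ; have fYZ : f @: Y :&: f @: Z = set0.
  apply/setP=> k; rewrite !inE; apply/negP=> /andP[/imsetP[y yY ->]].
  by case/imsetP=> z zZ /eqP; apply/negP/nYZ.
rewrite -cardsUI fYZ cards0 addn0 -imsetU subset_leq_card //.
by rewrite imsetS // subUset YX.
Qed.

Lemma one_tough_seq (K : eqType) S (f : G -> K) (s : seq G) :
  one_tough G -> locally_const S f -> {in s, forall x, x \notin S} ->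
  uniq (map f s) -> 1 < size s -> size s <= #|S|.
Proof.
move=> tG fS sS us s1; pose g x := odflt x [pick y | f y == f x].
have fg x : f (g x) = f x.
  by rewrite /g; case: pickP => [y /eqP|/(_ x)] //; rewrite eqxx.
have gf x y : f x = f y -> g x = g y.
  move=> fxy; rewrite /g (eq_pick (_ : _ =1 (fun z => f z == f y))).
    by case: pickP => // /(_ x); rewrite fxy eqxx.
  by move=> z; rewrite fxy.
have ug : uniq (map g s).
  by apply: (@map_uniq _ _ f); rewrite -map_comp (eq_map fg).
have le_s : size s <= #|g @: ~: S|.
  rewrite -(size_map g) -(card_uniqP ug) subset_leq_card //.
  apply/subsetP => _ /mapP[x xs ->]; apply: imset_f.
  by rewrite inE sS.
apply: (leq_trans le_s); apply: tG => [x y xS yS xy|].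
  by apply/gf/fS.
exact: leq_trans s1 le_s.
Qed.

Lemma cut_vertex (K : eqType) S (f : G -> K) x y :
  one_tough G -> #|S| <= 1 -> locally_const S f -> x \notin S -> y \notin S ->
  f x = f y.
Proof.
move=> tG S1 fS xS yS; apply/eqP; apply: contraTT S1 => nfxy; rewrite -ltnNge.
apply: (@one_tough_seq _ _ f [:: x; y]) => // [z|]; last by rewrite /= inE nfxy.
by rewrite !inE => /orP[]/eqP->.
Qed.

(** Putting back the edge [uv] merges the colours of its ends. *)
Definition glue (f : G -> G) u v x := if f x == f v then f u else f x.

Lemma glue_lc u v T f : critical_cut u v T f -> locally_const T (glue f u v).
Proof.
case=> uT vT nuv fT cT x y xT yT xy; rewrite /glue.
have [/orP[]/andP[/eqP-> /eqP->]|nxy] :=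
  boolP ((x == u) && (y == v) || (x == v) && (y == u));
    rewrite ?eqxx ?if_same //.
by rewrite (fT x y).
Qed.

Lemma glue_card f u v (A : {set G}) : #|f @: A| <= #|glue f u v @: A|.+1.
Proof.
rewrite -add1n -(cards1 (f v)); apply: leq_trans (leq_card_setU _ _).
apply/subset_leq_card/subsetP => _ /imsetP[x xA ->]; rewrite !inE.
have [//|nf] := eqVneq (f x) (f v); apply/imsetP; exists x => //.
by rewrite /glue (negbTE nf).
Qed.

End Colorings.

(** The pair [{a, b}] separates the nonempty set [C] from a nonempty rest; [C]
is a union of components of [G - a - b], and 1-toughness makes it a single one.
*)
Record two_cut (G : sgraph) (a b : G) (C : {set G}) : Prop := TwoCut {
  tc_neq : a != b;
  tc_aC : a \notin C;
  tc_bC : b \notin C;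
  tc_in : exists c, c \in C;
  tc_out : exists e, [/\ e \notin C, e != a & e != b];
  tc_nbr : forall x y, x \in C -> adj x y -> y \notin C ->
    (y == a) || (y == b) }.

(** A path through all of [C] that can be prolonged to [a] in front and to [b]
at the end. *)
Definition ham_path (G : sgraph) (a b : G) (C : {set G}) :=
  exists x p, [/\ uniq (x :: p), x :: p =i C, path adj x p, adj a x
    & adj (last x p) b].

Definition join (G : sgraph) (A B : {set G}) :=
  forall x y, x \in A -> y \in B -> adj x y.

(** Here [M] is the component of [G - S] that contains the edge [uv]; the
vertex [v] is a leaf of [M] and [u] dominates [M]. The colouring [g] counts the
components other than [M], of which there are at least [#|S| - 1]. *)
Record pendant (G : sgraph) (S : {set G}) (u v : G) (M : {set G}) (g :
  G -> G) : Prop :=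
  Pendant {
  pd_adj : adj u v;
  pd_uM : u \in M;
  pd_vM : v \in M;
  pd_MS : forall w, w \in M -> w \notin S;
  pd_leaf : forall w, adj v w -> w != u -> w \in S;
  pd_center : forall w, w \in M -> w != u -> adj u w;
  pd_closed : forall w z, w \in M -> adj w z -> z \notin S -> z \in M;
  pd_lc : locally_const (S :|: M) g;
  pd_card : #|S| <= #|g @: ~: (S :|: M)|.+1;
  pd_size : 2 < #|S| }.

Section MinimallyTough.
Context {G : sgraph}.
Implicit Types (a b c d e p q r t u v w x y z : G).
Implicit Types (A B C K M O P Q S T X : {set G}).
Hypothesis tG : one_tough G.
Hypothesis gt3 : 3 < #|G|.
Hypothesis critG : forall u v, adj u v -> exists T f, critical_cut u v T f.
Hypothesis freeG : forall a b c d e : G, adj a b -> adj b c -> adj c d ->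
  ~~ adj a c -> ~~ adj a d -> ~~ adj b d ->
  ~~ adj a e -> ~~ adj b e -> ~~ adj c e -> ~~ adj d e -> False.

(** * Domination between adjacent vertices *)

Lemma other_vertex (s : seq G) : size s <= 3 -> exists x, x \notin s.
Proof.
move=> s3; apply/existsP; rewrite -negb_forall;
  apply: contraL gt3 => /forallP sG.
rewrite -leqNgt; apply: leq_trans s3; apply: leq_trans (card_size s).
by apply/subset_leq_card/subsetP => x _.
Qed.

(** If all neighbours of [t] outside [T] were in the component of the edge
[uv], then [T - t] would leave as many components as [T], which is one more
than 1-toughness allows. *)
Lemma critical_seen u v T f t : critical_cut u v T f -> t \in T -> 1 < #|T| ->
  exists w, [/\ w \notin T, adj t w, f w != f u & f w != f v].
Proof.
move=> cT tT T1; suff /existsP[w /and4P[? ? ? ?]] :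
  [exists w, [&& w \notin T, adj t w, f w != f u & f w != f v]] by exists w.
apply: contraT; rewrite negb_exists => /forallP seen.
have [uT vT nuv fT cardT] := cT.
(* the colour of [t] is that of the only component it sees *)
pose g x := if x == t then f u else glue f u v x.
have tE x : x \notin T -> x == t = false by apply: contraNF => /eqP->.
have gE x : x \notin T -> g x = glue f u v x by move=> xT; rewrite /g tE.
have tg y : y \notin T -> adj t y -> glue f u v y = f u.
  move=> yT ty; have := seen y; rewrite yT ty /= negb_and !negbK /glue.
  by case/orP=> /eqP->; rewrite ?eqxx ?if_same.
have gT : locally_const (T :\ t) g.
  move=> x y; rewrite !inE !negb_and !negbK =>
    /orP[/eqP->|xT] /orP[/eqP->|yT] //.
  - by move=> ty; rewrite [g y]gE // tg // /g eqxx.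
  - by rewrite adjC => ty; rewrite [g x]gE // tg // /g eqxx.
  - by rewrite !gE //; apply: (glue_lc cT).
have cardg : #|T| <= #|g @: ~: (T :\ t)|.
  rewrite -ltnS; apply: leq_trans cardT _.
  apply: leq_trans (glue_card f u v (~: T)) _; rewrite ltnS.
  apply: leq_trans (_ : #|g @: ~: T| <= _).
    apply: subset_leq_card; apply/subsetP => _ /imsetP[x xT ->].
    by rewrite -gE ?imset_f //; rewrite inE in xT.
  by rewrite subset_leq_card // imsetS // setCS subsetDl.
have := tG gT (leq_trans T1 cardg).
by rewrite leqNgt (leq_trans _ cardg) // (cardsD1 t T) tT ltnS.
Qed.

Lemma has_nbr u v : v != u -> exists s, adj v s && (s != u).
Proof.
move=> vu; apply/existsP; apply: contraT; rewrite negb_exists => /forallP Nv.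
have [|w] := @other_vertex [:: u; v]; first by [].
rewrite !inE negb_or => /andP[wu wv].
have : (v == v) = (w == v).
  apply: (cut_vertex (S := [set u]) (f := fun x => x == v)) tG _ _ _ _.
  - by rewrite cards1.
  - move=> x y; rewrite !inE => xu yu xy; apply/eqP/eqP => E; subst.
      by have := Nv y; rewrite xy yu.
    by have := Nv x; rewrite adjC xy xu.
  - by rewrite inE.
  - by rewrite inE.
by rewrite eqxx (negbTE wv).
Qed.

(** Otherwise every common neighbour [s] of [u] and [v] forces [v] into the
critical set of [us], where it sees only the component of that edge. By
[critical_seen] this critical set is [{v}], which makes [s] a vertex of degree
two. The same argument for the edge [uv], whose critical set must then be
[{s}], leaves [v] with the neighbours [u] and [s] only, so [u] would be a cut
vertex. *)
Lemma private_nbr u v : adj u v ->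
  exists w, [/\ adj v w, w != u & ~~ adj u w].
Proof.
move=> uv; have vu : v != u by rewrite eq_sym (adj_neq uv).
suff /existsP[w /and3P[? ? ?]] : [exists w, [&& adj v w, w != u & ~~ adj u w]].
  by exists w.
apply: contraT; rewrite negb_exists => /forallP Nvu.
have {}Nvu w : adj v w -> w != u -> adj u w.
  by move=> vw wu; have := Nvu w; rewrite vw wu /= negbK.
have [s /andP[vs su]] := has_nbr vu; have us := Nvu s vs su.
have sv : s != v by rewrite eq_sym (adj_neq vs).
have [T [f cT]] := critG us; have [uT sT nus fT cardT] := cT.
have vT : v \in T.
  apply: contraR nus => vT; rewrite (fT u v) //; last first.
    by rewrite (negbTE vu) andbF orbF eqxx eq_sym sv.
  by rewrite (fT v s) // (negbTE vu) (negbTE su) andbF.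
have T1 : #|T| <= 1.
  rewrite leqNgt; apply/negP => /(critical_seen cT vT)[w [wT vw nwu nws]].
  have wu : w != u by apply: contraNneq nwu => ->.
  have ws : w != s by apply: contraNneq nws => ->.
  case/eqP: nwu; apply: fT; rewrite // 1?adjC ?Nvu //.
  by rewrite (negbTE wu) (negbTE ws).
have TE : T = [set v].
  by apply/eqP; rewrite eq_sym eqEcard sub1set vT cards1.
have Ns w : adj s w -> w \in [set u; v].
  move=> sw; rewrite !inE; apply: contraT; rewrite negb_or => /andP[wu wv].
  have ws : w != s by rewrite eq_sym (adj_neq sw).
  have wT : w \notin T by rewrite TE inE.
  have : ((w != v) && (f w == f s)) = ((u != v) && (f u == f s)).
    apply: (cut_vertex (S := [set s])
      (f := fun x => (x != v) && (f x == f s))) tG _ _ _ _.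
    - by rewrite cards1.
    - suff main x y : x != s -> y != s -> adj x y -> x != v -> f x = f s ->
          (y != v) && (f y == f s).
        move=> x y; rewrite !inE => xs ys xy; apply/idP/idP.
          by case/andP=> xv /eqP; apply: main ys xy xv.
        by case/andP=> yv /eqP; apply: main xs _ yv; rewrite // adjC.
      move=> xs ys xy xv fxs.
      have xu : x != u by apply: contraNneq nus => <-; apply/eqP.
      have yv : y != v.
        apply: contraNneq nus => yv; rewrite -fxs; apply/eqP/esym/fT => //.
        + by rewrite TE inE.
        + by rewrite adjC Nvu // -yv adjC.
        + by rewrite (negbTE xu) (negbTE xs).
      rewrite yv -fxs; apply/eqP/fT; rewrite ?TE ?inE // 1?adjC //.
      by rewrite (negbTE xs) (negbTE ys) !andbF.
    - by rewrite inE.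
    - by rewrite inE eq_sym.
  rewrite wv (negbTE nus) andbF /= (fT w s) ?eqxx // 1?adjC //.
  by rewrite (negbTE wu) (negbTE ws).
have [T2 [f2 cT2]] := critG uv; have [uT2 vT2 nuv2 fT2 cardT2] := cT2.
have sT2 : s \in T2.
  apply: contraR nuv2 => sT2; apply/eqP; transitivity (f2 s); apply: fT2 => //.
  - by rewrite (negbTE sv) (negbTE su) !andbF.
  - by rewrite adjC.
  - by rewrite (negbTE sv) (negbTE su).
have T21 : #|T2| <= 1.
  rewrite leqNgt; apply/negP => /(critical_seen cT2 sT2)[w [_ /Ns]].
  by rewrite !inE => /orP[]/eqP->; rewrite eqxx.
have T2E : T2 = [set s].
  by apply/eqP; rewrite eq_sym eqEcard sub1set sT2 cards1.
have Nv w : adj v w -> w \in [set u; s].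
  move=> vw; rewrite !inE; apply: contraT; rewrite negb_or => /andP[wu ws];
    case/eqP: nuv2.
  have wv : w != v by rewrite eq_sym (adj_neq vw).
  transitivity (f2 w); apply: fT2; rewrite ?T2E ?inE //.
  - by rewrite eq_sym.
  - exact: Nvu.
  - by rewrite (negbTE wv) (negbTE wu) !andbF.
  - by rewrite eq_sym.
  - by rewrite adjC.
  - by rewrite (negbTE wv) (negbTE wu).
have [|w] := @other_vertex [:: u; v; s]; first by [].
rewrite !inE !negb_or => /and3P[wu wv ws].
have : ((v == v) || (v == s)) = ((w == v) || (w == s)).
  apply: (cut_vertex (S := [set u]) (f :=
    fun x => (x == v) || (x == s))) tG _ _ _ _.
  - by rewrite cards1.
  - suff main x y : x != u -> y != u -> adj x y -> (x == v) || (x == s) ->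
        (y == v) || (y == s).
      move=> x y; rewrite !inE => xu yu xy.
      by apply/idP/idP; apply: main; rewrite // adjC.
    move=> _ yu xy /orP[]/eqP xE; rewrite xE in xy;
      [move: (Nv y xy) | move: (Ns y xy)];
      by rewrite !inE (negbTE yu) /= => ->; rewrite ?orbT.
  - by rewrite inE.
  - by rewrite inE.
by rewrite eqxx (negbTE wv) (negbTE ws).
Qed.

(** * Cuts with two vertices *)

Lemma two_cut_sym a b C : two_cut a b C -> two_cut b a C.
Proof.
case=> ab aC bC inC [e [eC ea eb]] nC; split; rewrite 1?eq_sym //.
  by exists e.
by move=> x y xC xy yC; rewrite orbC (nC x).
Qed.

Lemma two_cut_compl a b C : two_cut a b C -> two_cut a b (~: (C :|: [set a;
  b])).
Proof.
case=> ab aC bC [c cC] [e [eC ea eb]] nC; split; rewrite ?inE ?eqxx ?orbT //.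
- by exists e; rewrite !inE !negb_or eC ea eb.
- exists c; split; first by rewrite !inE cC.
    by apply: contraNneq aC => <-.
  by apply: contraNneq bC => <-.
- move=> x y; rewrite !inE !negb_or => /and3P[xC xa xb] xy.
  have [yC|yC] := boolP (y \in C); last by rewrite /= -negb_or negbK.
  by have := nC y x yC; rewrite adjC (negbTE xa) (negbTE xb) => /(_ xy xC).
Qed.

(** Otherwise removing [a] and [b] would leave three components. *)
Lemma two_cut_connected a b C (A : {set G}) : two_cut a b C -> A \subset C ->
  A != set0 -> C :\: A != set0 ->
    exists x y, [/\ x \in A, y \in C :\: A & adj x y].
Proof.
move=> [ab aC bC _ [e [eC ea eb]] nC] AC /set0Pn[x0 x0A] /set0Pn[y0 y0A].
suff /exists_inP[x xA /exists_inP[y yA xy]] :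
  [exists x in A, exists y in C :\: A, adj x y] by exists x, y; split.
apply: contraT; rewrite negb_exists_in => /forall_inP nA.
have {}nA x y : x \in A -> y \in C -> adj x y -> y \in A.
  move=> xA yC xy; apply: contraT => yA; have := nA x xA.
  by rewrite negb_exists_in => /forall_inP/(_ y);
    rewrite !inE yA yC xy => /(_ isT).
pose f x := if x \in A then 0 else if x \in C then 1 else 2.
have lcf : locally_const [set a; b] f.
  suff main x y : x \notin [set a; b] -> y \notin [set a; b] -> adj x y ->
      (x \in A -> y \in A) /\ (x \in C -> y \in C).
    move=> x y xS yS xy; have [xyA xyC] := main x y xS yS xy.
    have [|yxA yxC] := main y x yS xS; first by rewrite adjC.
    rewrite /f; have -> : (x \in A) = (y \in A) by apply/idP/idP.
    by have -> : (x \in C) = (y \in C) by apply/idP/idP.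
  move=> xS yS xy; have xyC : x \in C -> y \in C.
    by move=> xC; apply: contraR yS => yC; rewrite !inE (nC x).
  by split=> // xA; apply: (nA x y) => //; apply/xyC/(subsetP AC).
have [y0nA y0C] : y0 \notin A /\ y0 \in C by move: y0A; rewrite !inE => /andP[].
have x0C := subsetP AC _ x0A.
have nS z : z \in C -> z \notin [set a; b].
  by move=> zC; rewrite !inE negb_or; apply/andP; split;
    apply: contraTneq zC => ->.
have := @one_tough_seq _ _ [set a; b] f [:: x0; y0; e] tG lcf.
rewrite cards2 ab => /(_ _ _ isT); apply.
  move=> z; rewrite !in_cons in_nil orbF => /or3P[]/eqP->; try exact: nS.
  by rewrite !inE negb_or ea eb.
by rewrite /= /f x0A (negbTE y0nA) y0C (contraNF (subsetP AC e) eC) (negbTE eC).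
Qed.

Lemma two_cut_nbr a b C : two_cut a b C -> exists2 c, c \in C & adj a c.
Proof.
move=> [ab aC bC [c0 c0C] _ nC].
apply/exists_inP; apply: contraT; rewrite negb_exists_in => /forall_inP naC.
have : (c0 \in C) = (a \in C).
  apply: (cut_vertex (S := [set b]) (f := fun x => x \in C)) => //.
  - by rewrite cards1.
  - suff main x y : x \notin [set b] -> y \notin [set b] -> adj x y ->
        x \in C -> y \in C.
      by move=> x y xS yS xy; apply/idP/idP; apply: main; rewrite // adjC.
    move=> _; rewrite inE => yb xy xC; apply: contraT => yC.
    have := nC x y xC xy yC; rewrite (negbTE yb) orbF => /eqP yE.
    by have := naC x xC; rewrite adjC -yE xy.
  - by rewrite inE; apply: contraTneq c0C => ->.
  - by rewrite inE.
by rewrite c0C (negbTE aC).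
Qed.

(** A vertex on the other side of the cut has no neighbour in [C], so it would
complete an induced [P4] in [C] to [K1 + P4]. *)
Lemma two_cut_P4_free a b C : two_cut a b C -> P4_free (@adj G) C.
Proof.
case=> ab aC bC _ [e [eC ea eb]] nC x y z w xC yC zC wC xy yz zw nxz nxw nyw.
suff ne u : u \in C -> ~~ adj u e.
  by apply: (freeG xy yz zw) nxz nxw nyw (ne _ _) (ne _ _) (ne _ _) (ne _ _).
by move=> uC; apply/negP => /(nC u e uC)/(_ eC);
  rewrite (negbTE ea) (negbTE eb).
Qed.

(** A critical set inside [C] leaves [a] and [b] connected through the other
side: if they had different colours, the vertices beyond the cut with the
colour of [a] would be separated by [a] alone, so there are none; then [b]
alone would separate everything beyond the cut. *)
Lemma two_cut_linked a b C T f u v : two_cut a b C -> u \in C -> v \in C ->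
  critical_cut u v T f -> T \subset C -> f a = f b.
Proof.
move=> [ab aC bC [c cC] [e [eC ea eb]] nC] uC vC [uT vT _ fT _] TC.
have fE x y : x \notin C -> y \notin T -> adj x y -> f x = f y.
  move=> xC yT xy; apply: fT; rewrite ?(contraNN (subsetP TC x)) //.
  by apply/negP => /orP[]/andP[/eqP xE _]; rewrite xE ?uC ?vC in xC.
have outT x : x \notin C -> x \notin T by apply/contraNN/(subsetP TC).
have nout x y : x \notin C -> x != a -> x != b -> adj x y -> y \notin C.
  move=> xC xa xb; rewrite adjC => xy; apply/negP => yC.
  by have := nC y x yC xy xC; rewrite (negbTE xa) (negbTE xb).
apply/eqP; apply: contraT => nab.
have no_a x : x \notin C -> x != a -> x != b -> f x != f a.
  move=> xC xa xb; apply: contraT => /negPn/eqP fxa.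
  pose g y := [&& y \notin C, y != a & f y == f a].
  have : g x = g b.
    apply: (cut_vertex (S := [set a]) (f := g)) => //; rewrite ?cards1 ?inE //;
      last by rewrite eq_sym.
    suff main y z : y \notin [set a] -> z \notin [set a] -> adj y z ->
      g y -> g z.
      by move=> y z yS zS yz; apply/idP/idP; apply: main; rewrite // adjC.
    rewrite !inE /g => ya za yz /and3P[yC _ /eqP fya].
    have yb : y != b by apply: contraNneq nab => <-; rewrite fya.
    have zC := nout y z yC ya yb yz.
    by rewrite zC za -fya (fE y z) ?eqxx ?outT.
  by rewrite /g xC xa fxa eqxx eq_sym ab eq_sym (negbTE nab) bC.
pose g y := [&& y \notin C, y != a & y != b].
have : g e = g a.
  apply: (cut_vertex (S := [set b]) (f := g)) => //; rewrite ?cards1 ?inE //.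
  suff main y z : y \notin [set b] -> z \notin [set b] -> adj y z -> g y -> g z.
    by move=> y z yS zS yz; apply/idP/idP; apply: main; rewrite // adjC.
  rewrite !inE /g => _ zb yz /and3P[yC ya yb]; have zC := nout y z yC ya yb yz.
  rewrite zC zb andbT; apply/eqP => za; have := no_a y yC ya yb.
  by rewrite (fE y z) ?outT // za eqxx.
by rewrite /g eC ea eb eqxx andbF.
Qed.

(** Only the trace of [T] on [C] and on [{a, b}] matters, because the part of
[T] beyond the cut pays for itself: removing that part alone leaves at most as
many components as it has vertices, and one of these contains [C]. Hence the
[#|T| + 1] colours of [f] can only be accounted for if each vertex of [T] in
[C] is matched by one of [a], [b] whose component avoids [C], that is, whose
neighbours in [C] all belong to [T]. When [T] lies inside [C] there is no such
part; then [a] and [b] are connected, and one extra vertex of [T] is allowed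
for. *)
Lemma critical_two_cut a b C T f u v : two_cut a b C -> u \in C -> v \in C ->
    critical_cut u v T f ->
    (forall c, c \in C -> c \notin T -> f c = f u \/ f c = f v) ->
  [/\ #|T :&: C| + (a \in T) + (b \in T) <= 2,
      1 < #|T :&: C| -> forall c, c \in C -> adj a c || adj b c -> c \in T
    & 0 < #|T :&: C| -> [\/ forall c, c \in C -> adj a c -> c \in T,
        forall c, c \in C -> adj b c -> c \in T
      | [/\ a \notin T, b \notin T & f a = f b]]].
Proof.
move=> cut uC vC crit fC; have [ab aC bC inC outC nC] := cut.
have [uT vT nuv fT cardT] := crit.
(* [iso x]: the component of [x] in [G - T] avoids [C] *)
pose iso x := [&& x \notin T, f x != f u & f x != f v].
have isoP x : x \notin C -> iso x -> forall c, c \in C -> adj x c -> c \in T.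
  move=> xC /and3P[xT nxu nxv] c cC xc; apply: contraT => cT.
  have fxc : f x = f c.
    apply: fT => //; apply/negP => /orP[]/andP[/eqP xE _];
      by rewrite xE ?uC ?vC in xC.
  by have [] := fC c cC cT; rewrite -fxc => /eqP;
    rewrite ?(negbTE nxu) ?(negbTE nxv).
pose colors x : {set G} := if iso x then [set f x] else set0.
pose W := f u |: (f v |: (colors a :|: colors b)).
have WP x : x \in [set a; b] -> x \notin T -> f x \in W.
  move=> xab xT; rewrite !inE.
  have [//|nu] := eqVneq (f x) (f u); have [//|nv] := eqVneq (f x) (f v).
  by move: xab; rewrite !inE /colors => /orP[]/eqP<-;
    rewrite /iso xT nu nv set11 ?orbT.
have cardW : #|W| <= 2 + #|colors a :|: colors b|.
  by rewrite !cardsU1 addnA leq_add2r (leq_add (leq_b1 _) (leq_b1 _)).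
have cc x : #|colors x| <= iso x by rewrite /colors; case: (iso x);
  rewrite ?cards1 ?cards0.
pose R := (f @: ~: T) :\: W.
(* a colouring off the part of [T] beyond the cut, with one colour for
   everything that is or may be connected to [C] *)
pose g x := if (x \in C) || (f x \in W) then None else Some (f x).
have lcg : locally_const (T :\: C) g.
  suff main x y : x \notin T :\: C -> y \notin T :\: C -> adj x y ->
    x \in C -> y \notin C -> f y \in W.
    move=> x y xS yS xy; rewrite /g.
    have [xC|xC] := boolP (x \in C); have [yC|yC] := boolP (y \in C) => //=.
    - by rewrite (main x y).
    - by rewrite (main y x) // adjC.
    rewrite !inE xC yC /= in xS yS; rewrite (fT x y) //.
    by apply/negP => /orP[]/andP[/eqP xE _]; rewrite xE ?uC ?vC in xC.
  move=> xS yS xy xC yC; have := nC x y xC xy yC; rewrite -in_set2 => yab.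
  by apply: WP => //; rewrite !inE yC in yS.
have cardR : #|R|.+1 <= #|g @: ~: (T :\: C)|.
  have Sinj : injective (@Some G) by move=> ? ? [].
  rewrite -(card_imset _ Sinj).
  have -> : #|[set Some x | x in R]|.+1 = #|None |: [set Some x | x in R]|.
    by rewrite cardsU1; case: imsetP => // [[]].
  apply/subset_leq_card/subsetP => k; rewrite !inE => /orP[/eqP->|].
    by apply/imsetP; exists u; rewrite ?inE ?uC // /g uC.
  case/imsetP=> y; rewrite inE => /andP[yW /imsetP[x xT yE]] ->.
  rewrite inE in xT; have xC : x \notin C.
    apply: contra yW => xC; rewrite yE !inE.
    by have [] := fC x xC xT => ->; rewrite eqxx ?orbT.
  apply/imsetP; exists x; first by rewrite !inE xC.
  by rewrite /g (negbTE xC) -yE (negbTE yW).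
have ltT : #|T| < #|W| + #|R|.
  apply: leq_trans cardT _; rewrite -(cardsID W); apply: leq_add => //.
  by rewrite subset_leq_card // subsetIr.
have TE : #|T| = #|T :&: C| + #|T :\: C| by rewrite cardsID.
have gR : #|R|.+1 <= maxn 1 #|T :\: C|.
  rewrite leq_max; have [//|R1] := leqP #|R|.+1 1; apply/orP; right.
  by apply: (leq_trans cardR); apply: tG lcg (leq_trans _ cardR).
have ia : iso a + (a \in T) <= 1 by rewrite /iso; case: (a \in T);
  case: (f a != f u); case: (f a != f v).
have ib : iso b + (b \in T) <= 1 by rewrite /iso; case: (b \in T);
  case: (f b != f u); case: (f b != f v).
have cab : #|colors a :|: colors b| <= iso a + iso b.
  by apply: leq_trans (leq_card_setU _ _) _; apply: leq_add.
have [T0|T0] := posnP #|T :\: C|; last first.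
  have T1 : #|T :&: C| <= iso a + iso b.
    clear - ltT gR cardW cab TE T0; move: (iso a + iso b) cab => i cab.
    by rewrite maxnC (maxn_idPl T0) in gR; lia.
  split; first by clear - T1 ia ib; lia.
  - move=> T2 c cC; have /andP[ia1 ib1] : iso a && iso b.
      by move: (leq_trans T2 T1); case: (iso a); case: (iso b).
    by case/orP; [apply: isoP aC ia1 c cC | apply: isoP bC ib1 c cC].
  - move=> T2; have /orP[iso1|iso1] : iso a || iso b.
      by move: (leq_trans T2 T1); case: (iso a); case: (iso b).
      by constructor 1; apply: isoP aC iso1.
    by constructor 2; apply: isoP bC iso1.
have TC : T \subset C by rewrite -setD_eq0 -cards_eq0 T0.
have fab := two_cut_linked cut uC vC crit TC.
have aT : a \notin T by apply: contra aC; apply: subsetP.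
have bT : b \notin T by apply: contra bC; apply: subsetP.
have iab : iso b = iso a by rewrite /iso aT bT fab.
have cab1 : #|colors a :|: colors b| <= iso a.
  by rewrite /colors iab fab setUid; case: (iso a); rewrite ?cards1 ?cards0.
have T1 : #|T :&: C| <= (iso a).+1.
  clear - ltT gR cardW cab1 TE T0; move: (nat_of_bool (iso a)) cab1 => i cab1.
  by rewrite T0 maxn0 in gR; lia.
split; rewrite ?(negbTE aT) ?(negbTE bT) ?addn0.
- by apply: leq_trans T1 _; case: (iso a).
- move=> T2 c cC; have ia1 : iso a by move: (leq_trans T2 T1); case: (iso a).
  by case/orP; [apply: isoP aC ia1 c cC | apply: isoP bC _ c cC; rewrite iab].
- by move=> _; constructor 3.
Qed.

(** * Sides of a two-vertex cut that are joins *)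

Lemma ham_path_sym a b C : ham_path a b C -> ham_path b a C.
Proof.
case=> x [p [us eC px ax lb]]; exists (last x p), (rev (belast x p)).
have revE : last x p :: rev (belast x p) = rev (x :: p).
  by rewrite -rev_rcons -lastI.
split.
- by rewrite revE rev_uniq.
- by move=> z; rewrite revE mem_rev eC.
- by rewrite rev_path; apply: sub_path px => y z; rewrite adjC.
- by rewrite adjC.
- by rewrite adjC; case: p {us eC px lb revE} => //= y p;
    rewrite rev_cons last_rcons.
Qed.

Lemma join_sym A B : join A B -> join B A.
Proof. by move=> jAB x y xB yA; rewrite adjC jAB. Qed.

Lemma join_disjoint A B x : join A B -> x \in A -> x \in B -> False.
Proof. by move=> jAB xA xB; have := jAB x x xA xB; rewrite adj_irrefl. Qed.

Lemma critical_common u v T f w : critical_cut u v T f ->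
  adj u w -> adj v w -> w \in T.
Proof.
case=> uT vT nuv fT _ uw vw; apply: contraR nuv => wT.
have wu : w != u by rewrite eq_sym (adj_neq uw).
have wv : w != v by rewrite eq_sym (adj_neq vw).
rewrite (fT u w) // ?(fT v w) //.
  by rewrite (negbTE wu) (negbTE wv) !andbF.
by rewrite (negbTE wu) (negbTE wv) !andbF.
Qed.

Section JoinCut.
Variables (A B : {set G}) (u v : G) (T : {set G}) (f : G -> G).
Hypotheses (jAB : join A B) (uA : u \in A) (vB : v \in B).
Hypothesis crit : critical_cut u v T f.

Let AB x : x \in A -> x \in B -> False := @join_disjoint A B x jAB.

Lemma join_color_left x : x \in A -> x != u -> x \notin T -> f x = f v.
Proof.
case: crit => uT vT _ fT _ xA xu xT; apply: fT => //; first exact: jAB.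
rewrite (negbTE xu) /= negb_and; apply/orP; left.
by apply/eqP => xv; rewrite xv in xA; apply: (AB xA).
Qed.

Lemma join_color_right y : y \in B -> y != v -> y \notin T -> f y = f u.
Proof.
case: crit => uT vT _ fT _ yB yv yT; apply: fT => //; first by rewrite adjC jAB.
rewrite (negbTE yv) orbF negb_and; apply/orP; left.
by apply/eqP => yu; rewrite yu in yB; apply: (AB uA).
Qed.

Lemma join_colors c : c \in A :|: B -> c \notin T -> f c = f u \/ f c = f v.
Proof.
have [->|cu] := eqVneq c u; first by left.
have [->|cv] := eqVneq c v; first by right.
rewrite inE => /orP[cA|cB] cT; first by right; apply: join_color_left.
by left; apply: join_color_right.
Qed.

(** Two further vertices outside [T], one on each side of the join, would
connect [u] to [v] by a path of length three. *)
Lemma join_critical_side :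
  (forall x, x \in A -> x != u -> x \in T) \/
  (forall y, y \in B -> y != v -> y \in T).
Proof.
have [/existsP[x /and3P[xA xu xT]]|nA] :=
  boolP [exists x, [&& x \in A, x != u & x \notin T]].
  right=> y yB yv; apply: contraT => yT; have [uT vT nuv fT _] := crit.
  case/eqP: nuv; rewrite -(join_color_right yB yv yT) -(join_color_left xA xu
    xT).
  apply/esym/fT => //; first exact: jAB.
  rewrite (negbTE xu) (negbTE yv) !andbF /=; apply/negP => /andP[_ /eqP yu].
  by rewrite yu in yB; apply: (AB uA).
left=> x xA xu; apply: contraR nA => xT; apply/existsP; exists x.
by rewrite xA xu.
Qed.

End JoinCut.

(** If [a] and [b] were attached to [C] at the single vertex [v], it would be a
cut vertex. *)
Lemma two_cut_attached a b C v : two_cut a b C -> 1 < #|C| ->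
  exists c, [/\ c \in C, adj a c || adj b c & c != v].
Proof.
move=> cut C1; have [ca caC aca] := two_cut_nbr cut.
have [vC|vC] := boolP (v \in C); last first.
  exists ca; rewrite aca; split=> //; by apply: contraNneq vC => <-.
suff /existsP[c /and3P[]] :
  [exists c, [&& c \in C, adj a c || adj b c & c != v]].
  by exists c.
apply: contraT; rewrite negb_exists => /forallP nC.
have [ab aC bC _ _ nbrC] := cut.
have [c cC cv] : exists2 c, c \in C & c != v.
  have /card_gt0P[c] : 0 < #|C :\ v| by rewrite (cardsD1 v C) vC in C1.
  by rewrite !inE => /andP[cv cC]; exists c.
have : (c \in C) = (a \in C).
  apply: (cut_vertex (S := [set v]) (f := fun x => x \in C)) => //.
  - by rewrite cards1.
  - suff main x y : x \notin [set v] -> y \notin [set v] -> adj x y ->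
        x \in C -> y \in C.
      by move=> x y xS yS xy; apply/idP/idP; apply: main; rewrite // adjC.
    rewrite inE => xv _ xy xC; apply: contraT => yC.
    have := nC x; rewrite xC xv andbT /= negb_or => /andP[xa xb].
    by case/orP: (nbrC x y xC xy yC) => /eqP yE; rewrite yE adjC in xy;
      rewrite xy in xa xb.
  - by rewrite inE.
  - by rewrite inE; apply: contraNneq aC => ->.
by rewrite cC (negbTE aC).
Qed.

(** Since [a] dominates [C], the private neighbours that [private_nbr] gives to
the vertices of [C] must all be [b], so [b] dominates [C] as well. Then a
critical set of an edge inside [C] contains [a] and [b], hence nothing of [C],
so the edge is a bridge of [C] and one factor of the join is a single vertex
dominating [C], against [private_nbr]. *)
Lemma complete_side_single a b C : two_cut a b C ->
  (forall c, c \in C -> adj a c) -> exists c, C = [set c].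
Proof.
move=> cut cC; have [ab aC bC [c0 c0C] _ nbrC] := cut.
have bCab c : c \in C -> adj b c && ~~ adj a b.
  move=> cC'; have [w [cw wa naw]] := private_nbr (cC c cC').
  have wC : w \notin C by apply: contra naw; apply: cC.
  have := nbrC c w cC' cw wC; rewrite (negbTE wa) => /eqP wb.
  by rewrite -wb naw adjC cw.
have [C1|C1] := leqP #|C| 1.
  by exists c0; apply/eqP; rewrite eq_sym eqEcard sub1set c0C cards1.
have [A [[AC A0 CA nA]|[AC /set0Pn[u uA] /set0Pn[v vB] jA]]] :=
    cograph_split (@adj_sym G) (@adj_irrefl G) (two_cut_P4_free cut) C1.
  have [x [y [xA yA xy]]] := two_cut_connected cut AC A0 CA.
  by have := nA x y xA yA; rewrite /anti xy.
have uC := subsetP AC u uA; have vC : v \in C by move: vB;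
  rewrite inE => /andP[].
have uv := jA u v uA vB; have [T [f crit]] := critG uv.
have aT : a \in T by apply: (critical_common crit); rewrite adjC cC.
have bT : b \in T.
  by apply: (critical_common crit); rewrite adjC;
    apply: (proj1 (andP (bCab _ _))).
have CE : A :|: (C :\: A) = C by rewrite -{2}(setID C A) (setIidPr AC).
have [] := critical_two_cut cut uC vC crit _.
  by move=> c; rewrite -{1}CE; apply: (join_colors jA uA vB crit).
rewrite aT bT addn1 addn1 !ltnS leqn0 cards_eq0 => /eqP T0 _ _.
have nT c : c \in C -> c \notin T.
  by move=> cC'; apply/negP => cT; have := in_set0 c; rewrite -T0 inE cT cC'.
suff dom x y : x \in C -> y \in C -> adj x y ->
    (forall z, z \in C -> z != x -> adj x z) -> False.
  have [HA|HB] := join_critical_side jA uA vB crit.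
    case: (dom u v) => // z zC zu; apply: jA => //; rewrite inE zC andbT.
    by apply/negP => zA; have := HA z zA zu; rewrite (negbTE (nT z zC)).
  case: (dom v u) => //; first by rewrite adjC.
  move=> z zC zv; rewrite adjC jA //; apply: contraT => zA.
  by have := HB z; rewrite inE zA zC (negbTE (nT z zC)) => /(_ isT zv).
move=> xC yC xy domx; have [w [yw wx nxw]] := private_nbr xy.
case/negP: nxw; have [wC|wC] := boolP (w \in C); first exact: domx.
have /andP[bx _] := bCab x xC.
by case/orP: (nbrC y w yC yw wC) => /eqP->; rewrite adjC ?cC.
Qed.

(** Two vertices of [B] would be two components of [G - A], besides that of
[a]. *)
Lemma join_small_side a b A B x y : two_cut a b (A :|: B) -> join A B ->
  #|A| <= 2 -> (forall z, z \in B -> ~~ (adj a z || adj b z)) ->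
  (forall z w, z \in B -> w \in B -> ~~ adj z w) ->
  x \in B -> y \in B -> x = y.
Proof.
move=> cut jAB A2 nB iB xB yB; apply/eqP; apply: contraT => nxy.
have [ab aC bC _ _ nbrC] := cut.
pose f z := if z \in B then z else a.
have nf z w : z \notin A -> w \notin A -> adj z w -> z \in B -> False.
  move=> zA wA zw zB; have wB : w \notin B.
    by apply: contraTN zw => wB; apply: iB.
  have := nbrC z w; rewrite !inE zB orbT zw negb_or wA wB => /(_ isT isT isT).
  have := nB z zB; rewrite ![adj _ z]adjC negb_or => /andP[za zb].
  by case/orP=> /eqP wE; rewrite wE ?(negbTE za) ?(negbTE zb) in zw.
have aB : a \notin B by apply: contra aC; rewrite inE orbC => ->.
have := @one_tough_seq _ _ A f [:: x; y; a] tG _ _ _ isT.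
rewrite /= leqNgt ltnS A2 => H; apply: H.
- move=> z w zA wA zw; rewrite /f; case: ifP => zB; first by case: (nf z w).
  by case: ifP => // wB; case: (nf w z) => //; rewrite adjC.
- move=> z; rewrite !inE => /or3P[]/eqP->.
  + by apply/negP => xA; apply: (join_disjoint jAB xA xB).
  + by apply/negP => yA; apply: (join_disjoint jAB yA yB).
  + by apply: contra aC; rewrite inE => ->.
- rewrite /f xB yB (negbTE aB) !inE negb_or nxy /=.
  by rewrite !andbT; apply/andP; split; apply: contraNneq aB => <-.
Qed.

(** Let [U] be the set of vertices of [C] attached to [a] or [b]. For every
edge [uv] between the factors, [critical_two_cut] leaves two possibilities:
neither [u] nor [v] is in [U], or [A] is a pair [{u, u'}] and [v] is isolated
in [B]; in the latter case, if [v] is in [U], then [u'] is the only attachment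
of [a], or that of [b], or [U] has no element besides [u'] and [v]. If [U]
meets [B], exchanging [u] and [u'] gives incompatible attachments; if [U] lies
in [A], then [B] is independent, which [join_small_side] excludes. *)
Lemma join_large_absurd a b A B : two_cut a b (A :|: B) -> join A B ->
  1 < #|A| -> 2 < #|B| -> False.
Proof.
move=> cut jAB A1 B2; have [ab aC bC _ _ nbrC] := cut.
set C := A :|: B in cut aC bC nbrC.
pose U c := adj a c || adj b c.
have key u v : u \in A -> v \in B -> ~~ U u && ~~ U v \/
   exists u', [/\ A = [set u; u'], u' != u, forall y, y \in B -> ~~ adj v y
     & [\/ forall c, c \in C -> adj a c -> c = u',
           forall c, c \in C -> adj b c -> c = u',
           forall c, c \in C -> U c -> c = u' \/ c = v
         | ~~ U v]].
  move=> uA vB; have uC : u \in C by rewrite inE uA.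
  have vC : v \in C by rewrite inE vB orbT.
  have [T [f crit]] := critG (jAB u v uA vB); have [uT vT nuv fT _] := crit.
  have [le2 T2 T1] := critical_two_cut cut uC vC crit (join_colors jAB uA vB
    crit).
  have {T2} big : 1 < #|T :&: C| -> ~~ U u && ~~ U v.
    by move=> /T2 TU; apply/andP; split; apply/negP => Ux;
      [move: uT | move: vT]; rewrite TU.
  have [HA|HB] := join_critical_side jAB uA vB crit; last first.
    left; apply: big; apply: leq_trans (_ : #|B :\ v| <= _).
      by rewrite (cardsD1 v B) vB in B2.
    apply/subset_leq_card/subsetP => y; rewrite !inE => /andP[yv yB].
    by rewrite HB // yB orbT.
  have [u' u'A u'u] : exists2 u', u' \in A & u' != u.
    have /card_gt0P[u'] : 0 < #|A :\ u| by rewrite (cardsD1 u A) uA in A1.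
    by rewrite !inE => /andP[u'u u'A]; exists u'.
  have [/big|le1] := ltnP 1 #|T :&: C|; [by left | right].
  have u'T := HA u' u'A u'u.
  have u'TC : u' \in T :&: C by rewrite !inE u'T u'A.
  have TE : T :&: C = [set u'].
    by apply/eqP; rewrite eq_sym eqEcard sub1set u'TC cards1.
  have TC c : c \in C -> c \in T -> c = u'.
    by move=> cC cT; apply/set1P; rewrite -TE inE cT.
  exists u'; split=> //.
  - apply/setP => x; rewrite !inE; apply/idP/idP => [xA|].
      have [//|xu] := eqVneq x u; apply/eqP/TC; last exact: HA.
      by rewrite inE xA.
    by case/orP=> /eqP->.
  - move=> y yB; apply/negP => vy.
    have yT := critical_common crit (jAB u y uA yB) vy.
    have yu' : y = u' by apply: TC; rewrite // inE yB orbT.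
    by apply: (join_disjoint jAB u'A); rewrite -yu'.
  - have [|Ha|Hb|[aT bT fab]] := T1 _; first by rewrite TE cards1.
    + by constructor 1 => c cC ac; apply: TC cC (Ha c cC ac).
    + by constructor 2 => c cC bc; apply: TC cC (Hb c cC bc).
    (* here [a] and [b] have the same colour, so an attached [v] forces the
   attachments outside [T] into the class of [v], which is [{v}] within [C] *)
  have [Uv|nUv] := boolP (U v); last by constructor 4.
    constructor 3 => c cC Uc; have [cT|cT] := boolP (c \in T).
      by left; apply: TC.
    right; apply/eqP; apply: contraT => cv.
    have nab x : x \in C -> x != a /\ x != b.
      by move=> xC; split; apply: contraTneq xC => ->.
    have fU x : x \in C -> x \notin T -> U x -> f x = f a.
      move=> xC xT; case/orP=> Ux; [|rewrite fab]; apply: fT => //;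
        rewrite 1?adjC //.
        apply/negP => /orP[]/andP[_ /eqP aE]; move: aC; rewrite aE ?uC ?vC //.
      apply/negP => /orP[]/andP[_ /eqP bE]; move: bC; rewrite bE ?uC ?vC //.
    case/eqP: nuv; rewrite (fU v) // -(fU c) //.
    have [->//|cu] := eqVneq c u.
    move: cC; rewrite inE => /orP[cA|cB].
      by case/negP: cT; apply: HA.
    by rewrite (join_color_right jAB uA crit cB cv cT).
have [ca caC aca] := two_cut_nbr cut.
have [cb cbC bcb] := two_cut_nbr (two_cut_sym cut).
have C1 : 1 < #|C| by apply: leq_trans A1 _; rewrite subset_leq_card ?subsetUl.
have uniqB v u : v \in B -> U v -> u \in A -> exists u',
    [/\ A = [set u; u'], u' != u, U u'
      & (forall c, c \in C -> adj a c -> c = u') \/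
        (forall c, c \in C -> adj b c -> c = u') \/
        ~~ U u].
  move=> vB Uv uA; have [|[u' [AE u'u _ Hu']]] := key u v uA vB;
    first by rewrite Uv andbF.
  have uv : u != v by apply/eqP => E; apply: (join_disjoint jAB uA); rewrite E.
  exists u'; case: Hu' => [Ha|Hb|HU|]; last by rewrite Uv.
  - by split=> //; [rewrite /U -(Ha ca) ?aca | left].
  - by split=> //; [rewrite /U -(Hb cb) ?bcb ?orbT | right; left].
  have uC : u \in C by rewrite inE uA.
  have [c [cC Uc cv]] := two_cut_attached v cut C1.
  split=> //; first by have [<-|/eqP] := HU c cC Uc; rewrite ?(negbTE cv).
  right; right; apply/negP => Uu; have [/eqP|/eqP] := HU u uC Uu.
    by rewrite eq_sym (negbTE u'u).
  by rewrite (negbTE uv).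
have [/existsP[v /andP[vB Uv]]|nU] := boolP [exists v, (v \in B) && U v].
  have /card_gt0P[u uA] : 0 < #|A| by apply: leq_trans A1.
  have vC : v \in C by rewrite inE vB orbT.
  have [u' [AE u'u Uu' H1]] := uniqB v u vB Uv uA.
  have u'A : u' \in A by rewrite AE !inE eqxx orbT.
  have [u'' [AE' u''u' Uu'' H2]] := uniqB v u' vB Uv u'A.
  have u''E : u'' = u.
    have : u'' \in A by rewrite AE' !inE eqxx orbT.
    by rewrite AE !inE (negbTE u''u') orbF => /eqP.
  subst u''.
  have vA w : w \in A -> v != w.
    by move=> wA; apply/eqP => E; apply: (join_disjoint jAB wA); rewrite -E.
  have neq w : w = u -> w = u' -> False by move=> -> /eqP;
    rewrite (negbTE u''u').
  rewrite Uu' in H2; rewrite Uu'' in H1.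
  case: H1 => [Ha|[Hb|//]]; case: H2 => [Ha'|[Hb'|//]].
  - exact: (neq ca (Ha' ca caC aca) (Ha ca caC aca)).
  - case/orP: Uv => Uv; [case/negP: (vA u' u'A) | case/negP: (vA u uA)];
      apply/eqP.
      exact: Ha.
    exact: Hb'.
  - case/orP: Uv => Uv; [case/negP: (vA u uA) | case/negP: (vA u' u'A)];
      apply/eqP.
      exact: Ha'.
    exact: Hb.
  - exact: (neq cb (Hb' cb cbC bcb) (Hb cb cbC bcb)).
have nUB v : v \in B -> ~~ U v.
  by move=> vB; apply: contra nU => Uv; apply/existsP; exists v; rewrite vB.
have [u [uC Uu _]] := two_cut_attached a cut C1.
have uA : u \in A.
  by move: uC; rewrite inE => /orP[//|/nUB]; rewrite /U Uu.
have keyu v : v \in B -> #|A| <= 2 /\ forall y, y \in B -> ~~ adj v y.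
  move=> vB; have [|[u' [-> _ Hv _]]] := key u v uA vB; first by rewrite /U Uu.
  by rewrite cards2; split=> //; case: (u != u').
have /card_gt1P[x [y [xB yB nxy]]] : 1 < #|B| by apply: leq_trans B2.
case/eqP: nxy; apply: (join_small_side cut jAB) => //.
- by have [] := keyu x xB.
- by move=> z w zB wB; have [_] := keyu z zB; apply.
Qed.

(** A four-cycle, possibly with chords, has a Hamilton path from any vertex of
one factor to any vertex of the other. If the attachments of [a] and [b] allow
no such choice they all lie in one factor, whose removal then leaves too many
components or reveals two closed twins. *)
Lemma join_ham_path_22 a b A B : two_cut a b (A :|: B) -> join A B ->
  #|A| = 2 -> #|B| = 2 -> ham_path a b (A :|: B).
Proof.
move=> cut jAB A2 B2; have [ab aC bC _ _ nbrC] := cut.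
have path22 A' B' p q : join A' B' -> #|A'| = 2 -> #|B'| = 2 ->
  A' :|: B' = A :|: B ->
    p \in A' -> q \in B' -> adj a p -> adj b q -> ham_path a b (A :|: B).
  move=> jAB' A2' B2' <- pA qB ap bq.
  have /cards1P[p' pE] : #|A' :\ p| == 1 by move: A2';
    rewrite (cardsD1 p A') pA add1n => -[->].
  have /cards1P[q' qE] : #|B' :\ q| == 1 by move: B2';
    rewrite (cardsD1 q B') qB add1n => -[->].
  have /andP[p'p p'A] : (p' != p) && (p' \in A') by rewrite -in_setD1 pE set11.
  have /andP[q'q q'B] : (q' != q) && (q' \in B') by rewrite -in_setD1 qE set11.
  have dAB x y : x \in A' -> y \in B' -> x != y.
    by move=> xA yB; apply/eqP => E; apply: (join_disjoint jAB' xA); rewrite E.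
  have jBA := join_sym jAB'.
  exists p, [:: q'; p'; q]; split.
  - by rewrite /= !inE !negb_or (eq_sym p p') p'p q'q (eq_sym q' p') !dAB.
  - by move=> z; rewrite -(setD1K pA) -(setD1K qB) pE qE !inE;
      do ![case: (_ == _)].
  - by rewrite /= (jAB' p q') // (jBA q' p') // (jAB' p' q).
  - by [].
  - by rewrite adjC.
have CE : B :|: A = A :|: B by rewrite setUC.
have jBA := join_sym jAB.
have [ca caC aca] := two_cut_nbr cut.
have [cb cbC bcb] := two_cut_nbr (two_cut_sym cut).
suff absurd A' B' : join A' B' -> #|A'| = 2 -> #|B'| = 2 ->
  A' :|: B' = A :|: B ->
    (forall z, z \in B' -> ~~ (adj a z || adj b z)) -> False.
  suff main A' B' : join A' B' -> #|A'| = 2 -> #|B'| = 2 ->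
    A' :|: B' = A :|: B ->
      ca \in A' -> ham_path a b (A :|: B).
    by move: caC; rewrite inE => /orP[];
      [apply: main jAB _ _ _ | apply: main jBA _ _ _].
  move=> jAB' A2' B2' CE' caA.
  have [/existsP[q /andP[qB bq]]|nb] := boolP [exists q, (q \in B') && adj b q].
    exact: path22 jAB' A2' B2' CE' caA qB aca bq.
  have {}nb q : q \in B' -> ~~ adj b q.
    by move=> qB; apply: contra nb => bq; apply/existsP; exists q; rewrite qB.
  have cbA : cb \in A'.
    by move: cbC; rewrite -CE' inE => /orP[//|/nb]; rewrite bcb.
  have [/existsP[p /andP[pB ap]]|na] := boolP [exists p, (p \in B') && adj a p].
    apply: path22 (join_sym jAB') B2' A2' _ pB cbA ap bcb.
    by rewrite setUC.
  case: (absurd A' B') => // z zB; rewrite negb_or nb // andbT.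
  by apply: contra na => az; apply/existsP; exists z; rewrite zB.
move=> jAB' A2' B2' CE' nU.
have {}cut : two_cut a b (A' :|: B') by rewrite CE'.
have {aC bC nbrC} [_ aC bC _ _ nbrC] := cut.
have /cards2P[x [y [nxy BE]]] : #|B'| == 2 by rewrite B2'.
have xB : x \in B' by rewrite BE !inE eqxx.
have yB : y \in B' by rewrite BE !inE eqxx orbT.
have [xy|nadj] := boolP (adj x y).
  have [w [yw wx nxw]] := private_nbr xy.
  have yC : y \in A' :|: B' by rewrite inE yB orbT.
  have [wC|wC] := boolP (w \in A' :|: B').
    move: wC; rewrite BE !inE (negbTE wx) => /orP[wA|/eqP wy].
      by move: nxw; rewrite adjC jAB'.
    by rewrite wy adj_irrefl in yw.
  have := nU y yB; rewrite ![adj _ y]adjC.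
  by case/orP: (nbrC y w yC yw wC) => /eqP wE; rewrite wE in yw;
    rewrite yw ?orbT.
have A2le : #|A'| <= 2 by rewrite A2'.
case/eqP: nxy; apply: (join_small_side cut jAB' A2le nU) => // z w.
by rewrite BE !inE => /orP[]/eqP-> /orP[]/eqP->; rewrite ?adj_irrefl // adjC.
Qed.

Lemma join_ham_path a b A B : two_cut a b (A :|: B) -> join A B ->
  1 < #|A| -> 1 < #|B| -> ham_path a b (A :|: B).
Proof.
move=> cut jAB A1 B1; have [B2|B2] := ltnP 2 #|B|.
  by case: (join_large_absurd cut jAB A1 B2).
have [A2|A2] := ltnP 2 #|A|.
  rewrite setUC in cut.
  by case: (join_large_absurd cut (join_sym jAB) B1 A2).
by apply: join_ham_path_22 => //; apply/eqP; rewrite eqn_leq ?A2 ?B2.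
Qed.

(** * Sides of a two-vertex cut with a dominating vertex *)

Section Dominating.
Variables (a b u : G) (B : {set G}).
Hypotheses (cut : two_cut a b (u |: B)) (uB : u \notin B).
Hypothesis jB : join [set u] B.

Let uBadj y : y \in B -> adj u y. Proof. by apply: jB; rewrite inE. Qed.

(** Removing [u], [a] and [b] would leave four components: [x], [y], the one of
[z], and the other side of the cut. *)
Lemma dominating_cut3 x y z : x \in B -> y \in B -> z \in B ->
  (forall w, w \in B -> ~~ adj x w) -> (forall w, w \in B -> ~~ adj y w) ->
  uniq [:: x; y; z] -> False.
Proof.
move=> xB yB zB xiso yiso; have [ab aC bC _ [e [eC ea eb]] nbrC] := cut.
rewrite /= !inE negb_or andbT => /andP[/andP[xy xz] yz].
pose f w := if w \in B then if w == x then 0 else if w == y then 1 else 2 else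
  3.
have abB w : w \in B -> (w != a) && (w != b).
  by move=> wB; apply/andP; split;
    [apply: contraNneq aC | apply: contraNneq bC];
    move=> <-; rewrite inE wB orbT.
have eB : e \notin B by apply: contra eC; rewrite inE orbC => ->.
have := @one_tough_seq _ _ (u |: [set a; b]) f [:: x; y; z; e] tG _ _ _ isT.
have S3 : #|u |: [set a; b]| <= 3 by rewrite cardsU1 cards2 ab;
  case: (_ \notin _).
rewrite /= leqNgt ltnS S3 => H; suff: ~~ true by []; apply: H.
- suff main w w' : w \notin u |: [set a; b] -> w' \notin u |: [set a;
    b] -> adj w w' ->
      w \in B -> w' \in B.
    move=> w w' wS w'S ww'; rewrite /f.
    have <- : (w \in B) = (w' \in B).
      by apply/idP/idP; apply: main; rewrite // adjC.
    case: ifP => // wB; have w'B := main w w' wS w'S ww' wB.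
    have -> : (w == x) = false.
      by apply: contraTF ww' => /eqP->; apply: xiso.
    have -> : (w' == x) = false.
      by apply: contraTF ww' => /eqP->; rewrite adjC; apply: xiso.
    have -> : (w == y) = false.
      by apply: contraTF ww' => /eqP->; apply: yiso.
    have -> // : (w' == y) = false.
      by apply: contraTF ww' => /eqP->; rewrite adjC; apply: yiso.
  rewrite !inE !negb_or => _ /and3P[w'u w'a w'b] ww' wB; apply: contraT => w'B.
  have := nbrC w w'; rewrite !inE wB orbT ww' (negbTE w'u) (negbTE w'B).
  by rewrite (negbTE w'a) (negbTE w'b) => /(_ isT isT isT).
- have inS w : w \in B -> w \notin u |: [set a; b].
    move=> wB; have /andP[wa wb] := abB w wB.
    by rewrite !inE !negb_or wa wb !andbT; apply: contraNneq uB => <-.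
  move=> w; rewrite !in_cons in_nil orbF => /or4P[]/eqP->; try exact: inS.
  by rewrite !inE !negb_or ea eb !andbT; apply: contraNneq eC => ->;
    rewrite !inE eqxx.
- rewrite /= /f xB yB zB (negbTE eB) eqxx eq_sym (negbTE xy) eqxx.
  by rewrite eq_sym (negbTE xz) eq_sym (negbTE yz).
Qed.

Lemma dominated_single v K :
  two_cut u v K -> K \subset B -> exists r, K = [set r].
Proof.
move=> cutK KB; apply: (complete_side_single cutK).
by move=> c cK; apply/uBadj/(subsetP KB).
Qed.

(** The vertex [p'] that [p] misses exists by [private_nbr]. The critical set
of the edge [up] contains their common neighbour [a]; a neighbour [w] of [p] in
[B] would be a second vertex, which exhausts the bound of [critical_two_cut],
and then [u p' b p] avoids the critical set. *)
Lemma dominating_isolated p : adj a u -> ~~ adj b u -> p \in B -> adj a p ->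
  (forall y, y \in B -> adj b y) ->
  (exists2 p', p' \in B & (p' != p) && ~~ adj p p') /\
  (forall w, w \in B -> ~~ adj p w).
Proof.
move=> au nbu pB ap bB; have [ab aC bC _ _ nbrC] := cut.
have uC : u \in u |: B by rewrite !inE eqxx.
have BC y : y \in B -> y \in u |: B by rewrite !inE orbC => ->.
have up := uBadj pB.
have [p' [up' p'p npp']] : exists p', [/\ adj u p', p' != p & ~~ adj p p'].
  by apply: (private_nbr); rewrite adjC.
have p'B : p' \in B.
  have [p'C|p'C] := boolP (p' \in u |: B).
    move: p'C; rewrite !inE => /orP[/eqP p'u|//].
    by rewrite p'u adj_irrefl in up'.
  case/orP: (nbrC u p' uC up' p'C) => /eqP p'E.
    by rewrite p'E adjC ap in npp'.
  by rewrite p'E adjC (negbTE nbu) in up'.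
split=> [|w wB]; first by exists p'; rewrite // p'p.
apply/negP => pw; have [T [f crit]] := critG up; have [uT pT nup fT _] := crit.
have uin : u \in [set u] by rewrite inE.
have [le2 _ _] := critical_two_cut cut uC (BC p pB) crit
  (join_colors jB uin pB crit).
have aT : a \in T by apply: (critical_common crit); rewrite adjC.
have wT : w \in T by apply: (critical_common crit) pw; apply: uBadj.
have wTC : w \in T :&: (u |: B) by rewrite inE wT BC.
have T1 : 0 < #|T :&: (u |: B)| by apply/card_gt0P; exists w.
move: le2; rewrite aT addn1; case: (boolP (b \in T)) => [_|bT].
  by rewrite addn1 !ltnS leqNgt T1.
rewrite addn0 ltnS => le1; have TE : T :&: (u |: B) = [set w].
  by apply/eqP; rewrite eq_sym eqEcard sub1set wTC cards1.
have p'T : p' \notin T.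
  apply: contra npp' => p'T; have : p' \in [set w] by rewrite -TE inE p'T BC.
  by rewrite inE => /eqP->.
have bu : b != u by apply: contraNneq bC => ->.
have bp : b != p by apply: contraNneq bC => ->; apply: BC.
have p'u : p' != u by rewrite eq_sym (adj_neq up').
case/eqP: nup; transitivity (f p').
  by apply: fT; rewrite // (negbTE p'u) (negbTE p'p) !andbF.
transitivity (f b); apply: fT => //.
- by rewrite adjC bB.
- by rewrite (negbTE bu) (negbTE bp) !andbF.
- exact: bB.
- by rewrite (negbTE bu) (negbTE bp).
Qed.

(** Every vertex of [B] sees [b], by [private_nbr]. If no vertex of [B] sees
[a], then [B] is a side of the cut [{u, b}] that [u] dominates, hence a single
vertex. Otherwise some [p] in [B] sees [a] and is isolated in [B]. In the same
way, or by counting the components of [G - u - a - b], only one further vertex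
[r] remains, and the path is [p], [u], [r]. *)
Lemma dominating_one_end : 0 < #|B| -> adj a u -> ~~ adj b u ->
  ham_path a b (u |: B).
Proof.
move=> /card_gt0P[v0 v0B] au nbu; have [ab aC bC _ outC nbrC] := cut.
have uC : u \in u |: B by rewrite !inE eqxx.
have BC y : y \in B -> y \in u |: B by rewrite !inE orbC => ->.
have aB : a \notin B by apply: contra aC; apply: BC.
have bB' : b \notin B by apply: contra bC; apply: BC.
have ua : u != a by apply: contraNneq aC => <-.
have ub : u != b by apply: contraNneq bC => <-.
have bB y : y \in B -> adj b y.
  move=> yB; have [w [yw wu nuw]] := private_nbr (uBadj yB).
  have wC : w \notin u |: B.
    by rewrite !inE negb_or wu; apply: contra nuw; apply: uBadj.
  case/orP: (nbrC y w (BC y yB) yw wC) => /eqP wE; last by rewrite adjC -wE.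
  by rewrite wE adjC au in nuw.
have inner x y : x \in B -> adj x y -> y \notin B ->
  [|| y == u, y == a | y == b].
  move=> xB xy yB; have [//|yu] := eqVneq y u.
  by apply: nbrC (BC x xB) xy _; rewrite !inE negb_or yu.
have [/existsP[p /andP[pB ap]]|na] := boolP [exists p, (p \in B) && adj a p];
  last first.
  have [||r BE] := @dominated_single b B; rewrite ?subxx //.
    split=> //; [by exists v0 | by exists a;
      rewrite eq_sym | move=> x y xB xy yB].
    case/or3P: (inner x y xB xy yB) => /eqP yE; rewrite yE ?eqxx ?orbT //.
    by case/negP: na; apply/existsP; exists x; rewrite xB adjC -yE.
  have rB : r \in B by rewrite BE inE.
  exists u, [:: r]; split=> //.
  - by rewrite /= !inE andbT; apply: contraNneq uB => ->.
  - by move=> z; rewrite BE !inE.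
  - by rewrite /= uBadj.
  - by rewrite /= adjC bB.
have [[p' p'B /andP[p'p npp']] piso] := dominating_isolated au nbu pB ap bB.
suff [r [rp BE]] : exists r, r != p /\ B = [set p; r].
  have rB : r \in B by rewrite BE !inE eqxx orbT.
  exists p, [:: u; r]; split=> //.
  - rewrite /= !inE negb_or andbT (eq_sym p r) rp andbT.
    by rewrite (eq_sym p u); apply/andP; split; apply: contraNneq uB => ->.
  - by move=> z; rewrite BE !inE; do ![case: (_ == _)].
  - by rewrite /= adjC !uBadj.
  - by rewrite /= adjC bB.
have BD y : y \in B -> y != p -> y \in B :\ p by move=> yB yp; rewrite !inE yp.
suff [r rE] : exists r, B :\ p = [set r].
  exists r; have : r \in B :\ p by rewrite rE inE.
  by rewrite !inE => /andP[rp _]; rewrite -(setD1K pB) rE.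
have [/existsP[r /and3P[rB rp ar]]|na] :=
    boolP [exists r, [&& r \in B, r != p & adj a r]].
  have [_ riso] := dominating_isolated au nbu rB ar bB.
  exists r; apply/eqP; rewrite eq_sym eqEsubset sub1set BD //=.
  apply/subsetP => z; rewrite !inE => /andP[zp zB]; apply: contraT => zr.
  case: (dominating_cut3 pB rB zB piso riso).
  by rewrite /= !inE negb_or andbT (eq_sym p r) rp (eq_sym p z) zp (eq_sym r z)
    zr.
apply: (@dominated_single b); rewrite ?subD1set //; split=> //.
- by apply: contra uB; rewrite inE => /andP[].
- by apply: contra bB'; rewrite inE => /andP[].
- by exists p'; apply: BD.
- by exists a; split; rewrite ?inE ?(negbTE aB) ?andbF // eq_sym.
move=> x y; rewrite !inE => /andP[xp xB] xy; rewrite negb_and negbK => yB'.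
have yB : y \notin B.
  case/orP: yB' => // /eqP yp; have := piso x xB; by rewrite adjC -yp xy.
case/or3P: (inner x y xB xy yB) => /eqP yE; rewrite yE ?eqxx ?orbT //.
by case/negP: na; apply/existsP; exists x; rewrite xB xp adjC -yE.
Qed.

Section NoEnd.
Hypotheses (nau : ~~ adj a u) (nbu : ~~ adj b u).

Lemma dominating_attached v : v \in B -> adj a v || adj b v.
Proof.
move=> vB; have [ab aC bC _ _ nbrC] := cut.
have [w [vw wu nuw]] := private_nbr (uBadj vB).
have wC : w \notin u |: B.
  by rewrite !inE negb_or wu; apply: contra nuw; apply: uBadj.
have vC : v \in u |: B by rewrite !inE vB orbT.
by case/orP: (nbrC v w vC vw wC) => /eqP<-; rewrite ![adj w v]adjC vw ?orbT.
Qed.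

Lemma dominating_not_complete v : v \in B ->
  exists w, [/\ w \in B, w != v & ~~ adj v w].
Proof.
move=> vB; have [ab aC bC _ _ nbrC] := cut.
have vu : adj v u by rewrite adjC uBadj.
have [w [uw wv nvw]] := private_nbr vu; exists w; split=> //.
have [wC|wC] := boolP (w \in u |: B).
  by move: wC; rewrite !inE => /orP[/eqP wu|//]; rewrite wu adj_irrefl in uw.
have uC : u \in u |: B by rewrite !inE eqxx.
by case/orP: (nbrC u w uC uw wC) => /eqP wE; move: uw;
  rewrite wE adjC ?(negbTE nau) ?(negbTE nbu).
Qed.

(** Two neighbours of [v] in [B] would both lie in the critical set of [uv]; by
[critical_two_cut] that set would then contain every vertex attached to [a] or
[b], but [v] is attached and avoids it. *)
Lemma dominating_degree v w w' : v \in B -> w \in B -> w' \in B ->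
  adj v w -> adj v w' -> w = w'.
Proof.
move=> vB wB w'B vw vw'; apply/eqP; apply: contraT => nww'.
have [T [f crit]] := critG (uBadj vB); have [uT vT _ _ _] := crit.
have uin : u \in [set u] by rewrite inE.
have uC : u \in u |: B by rewrite !inE eqxx.
have BC y : y \in B -> y \in u |: B by rewrite !inE orbC => ->.
have [_ T2 _] := critical_two_cut cut uC (BC v vB) crit
  (join_colors jB uin vB crit).
have inT y : y \in B -> adj v y -> y \in T :&: (u |: B).
  by move=> yB vy; rewrite inE BC // andbT (critical_common crit (uBadj yB)).
case/negP: vT; apply: T2 (BC v vB) (dominating_attached vB).
by apply/card_gt1P; exists w, w'; split; rewrite ?inT.
Qed.

(** By [dominating_degree] a component of [B] is [K1] or [K2]. The ends of a
[K2] must be distinguished by [private_nbr], and only [a] and [b] can do so. *)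
Lemma dominating_part K : K \subset B -> K != set0 -> B :\: K != set0 ->
  (forall x y, x \in K -> y \in B :\: K -> ~~ adj x y) ->
  (exists v, K = [set v]) \/
  (exists q r, [/\ K = [set q; r], q != r, adj q r, adj a q & adj b r]).
Proof.
move=> KB /set0Pn[v vK] /set0Pn[z zK] nK;
  have [ab aC bC _ [e [eC ea eb]] nbrC] := cut.
have [zB zK'] : z \in B /\ z \notin K by move: zK; rewrite inE => /andP[].
have KB' x : x \in K -> x \in B by apply: (subsetP KB).
have BC y : y \in B -> y \in u |: B by rewrite !inE orbC => ->.
have nKz x y : x \in K -> y \in B -> adj x y -> y \in K.
  move=> xK yB; apply: contraTT => yK; apply: nK => //; by rewrite inE yK.
(* K is connected: otherwise {u, a, b} cuts off four components *)
have conn (X : {set G}) x y : x \in X -> X \subset K -> y \in K -> y \notin X ->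
    exists x' y', [/\ x' \in X, y' \in K, y' \notin X & adj x' y'].
  move=> xX XK yK yX; have XK' := subsetP XK.
  suff /existsP[x' /existsP[y' /and4P[? ? ? ?]]] :
    [exists x', [exists y', [&& x' \in X, y' \in K, y' \notin X & adj x' y']]].
    by exists x', y'; split.
  apply: contraT; rewrite negb_exists => /forallP nX.
  have {}nX x' y' : x' \in X -> y' \in K -> adj x' y' -> y' \in X.
    move=> x'X y'K x'y'; apply: contraT => y'X; have := nX x'.
    by rewrite negb_exists => /forallP/(_ y'); rewrite x'X y'K y'X x'y'.
  pose f w := if w \in X then 0 else if w \in K then 1 else if w \in B then 2
    else 3.
  have XB w : w \in X -> w \in B by move/XK'/KB'.
  have eB : e \notin B by apply: contra eC; apply: BC.
  have := @one_tough_seq _ _ (u |: [set a; b]) f [:: x; y; z; e] tG _ _ _ isT.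
  have S3 : #|u |: [set a; b]| <= 3 by rewrite cardsU1 cards2 ab;
    case: (_ \notin _).
  rewrite /= leqNgt ltnS S3 => H; suff: ~~ true by []; apply: H.
  - suff main w w' : w \notin u |: [set a; b] -> w' \notin u |: [set a;
      b] -> adj w w' ->
        [/\ w \in X -> w' \in X, w \in K -> w' \in K & w \in B -> w' \in B].
      move=> w w' wS w'S ww'; have [XX KK BB] := main w w' wS w'S ww'.
      have [|XX' KK' BB'] := main w' w w'S wS; first by rewrite adjC.
      rewrite /f; have -> : (w \in X) = (w' \in X) by apply/idP/idP.
      have -> : (w \in K) = (w' \in K) by apply/idP/idP.
      by have -> : (w \in B) = (w' \in B) by apply/idP/idP.
    rewrite !inE !negb_or => _ /and3P[w'u w'a w'b] ww'.
    have BB : w \in B -> w' \in B.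
      move=> wB; apply: contraT => w'B.
      have := nbrC w w'; rewrite !inE wB orbT ww' (negbTE w'u) (negbTE w'B).
      by rewrite (negbTE w'a) (negbTE w'b) => /(_ isT isT isT).
    have KK : w \in K -> w' \in K.
      by move=> wK; apply: (nKz w) => //; apply/BB/KB'.
    by split=> // wX; apply: (nX w) => //; apply/KK/XK'.
  - have inS w : w \in B -> w \notin u |: [set a; b].
      move=> wB; rewrite !inE !negb_or; apply/and3P; split.
      + by apply: contraNneq uB => <-.
      + by apply: contraNneq aC => <-; apply: BC.
      + by apply: contraNneq bC => <-; apply: BC.
    move=> w; rewrite !in_cons in_nil orbF => /or4P[]/eqP->;
      try by apply: inS; auto.
    by rewrite !inE !negb_or ea eb !andbT; apply: contraNneq eC => ->;
      rewrite !inE eqxx.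
  - have zX : z \notin X by apply: contra zK'; apply: XK'.
    have eX : e \notin X by apply: contra eB; apply: XB.
    have eK : e \notin K by apply: contra eB; apply: KB'.
    by rewrite /f xX (negbTE yX) yK (negbTE zX) (negbTE zK') zB
      (negbTE eX) (negbTE eK) (negbTE eB).
have [/existsP[w0 /andP[w0K w0v]]|nw] :=
  boolP [exists w, (w \in K) && (w != v)]; last first.
  left; exists v; apply/eqP; rewrite eq_sym eqEsubset sub1set vK /=.
  apply/subsetP => w wK; rewrite inE; apply: contraT => wv.
  by case/negP: nw; apply/existsP; exists w; rewrite wK.
right; have [||||v' [w [/set1P-> wK wv vw]]] := conn [set v] v w0;
  rewrite ?inE ?sub1set //.
rewrite inE in wv.
have vB := KB' v vK; have wB := KB' w wK.
have wv' : adj w v by rewrite adjC.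
have KE : K = [set v; w].
  apply/eqP; rewrite eq_sym eqEsubset; apply/andP; split.
    by apply/subsetP => t; rewrite !inE => /orP[]/eqP->.
  apply/subsetP => t tK; apply: contraT => tvw.
  have [||x' [y' [x'vw y'K y'vw x'y']]] := conn [set v; w] v t _ _ tK tvw;
    first by rewrite !inE eqxx.
    by apply/subsetP => s; rewrite !inE => /orP[]/eqP->.
  have y'B := KB' y' y'K; move: y'vw; rewrite !inE negb_or => /andP[y'v y'w].
  move: x'vw; rewrite !inE => /orP[]/eqP E; rewrite E in x'y'.
    by rewrite (dominating_degree vB y'B wB x'y' vw) eqxx in y'w.
  by rewrite (dominating_degree wB y'B vB x'y' wv') eqxx in y'v.
(* each end of the edge vw has a neighbour in {a, b} that the other end misses *)
have priv x y : x \in B -> y \in B -> adj x y ->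
    (adj a y && ~~ adj a x) || (adj b y && ~~ adj b x).
  move=> xB yB xy; have [t [yt tx nxt]] := private_nbr xy.
  have tC : t \notin u |: B.
    rewrite !inE negb_or; apply/andP; split.
      by apply: contraNneq nxt => ->; rewrite adjC uBadj.
    apply/negP => tB; case/eqP: tx; apply: (dominating_degree yB) => //.
    by rewrite adjC.
  by case/orP: (nbrC y t (BC y yB) yt tC) => /eqP tE; rewrite tE adjC in yt;
    rewrite tE adjC in nxt; rewrite yt nxt ?orbT.
have := priv v w vB wB vw; have := priv w v wB vB wv'.
move=> /orP[]/andP[v1 w1] /orP[]/andP[w2 v2]; try by rewrite ?w2 ?v1 in w1 v2.
  by exists v, w; split; rewrite // eq_sym.
by exists w, v; split; rewrite // setUC.
Qed.

Lemma dominating_ham_path A :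
  split_by (anti (@adj G)) B A -> ham_path a b (u |: B).
Proof.
move=> [AB A0 BA nA]; have [ab aC bC _ _ nbrC] := cut.
have AB' := subsetP AB.
have BE : B = A :|: (B :\: A) by rewrite -{1}(setID B A) (setIidPr AB).
have nA' x y : x \in B :\: A -> y \in B :\: (B :\: A) -> ~~ adj x y.
  rewrite setDDr setDv set0U => xBA; rewrite inE => /andP[_ yA].
  by rewrite adjC; apply: nA.
have A0' : B :\: (B :\: A) != set0.
  by rewrite setDDr setDv set0U (setIidPr AB).
have uB' v : v \in B -> u != v by move=> vB; apply: contraNneq uB => ->.
have neqAB x y : x \in A -> y \in B :\: A -> x != y.
  by move=> xA; rewrite inE => /andP[yA _]; apply: contraNneq yA => <-.
have sub x : x \in B :\: A -> x \in B by rewrite inE => /andP[].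
have end1 K L v q r : K = [set v] -> L = [set q; r] -> B = K :|: L ->
    v \in B -> q \in B -> r \in B -> q != r -> v != q -> v != r ->
    adj q r -> adj a q -> adj b r -> ham_path a b (u |: B).
  move=> KE LE {}BE vB qB rB qr vq vr aqr aq br.
  have memE s : s =i [:: u; v; q; r] -> s =i u |: B.
    by move=> sE z; rewrite sE BE KE LE !inE.
  have [av|bv] := orP (dominating_attached vB).
    exists v, [:: u; q; r]; split=> //; last by rewrite adjC.
    - by rewrite /= !inE !negb_or vq vr qr !uB' // eq_sym uB'.
    - by apply: memE => z; rewrite !inE; do ![case: (_ == _)].
    - by rewrite /= aqr (adjC v u) !uBadj.
  exists q, [:: r; u; v]; split=> //; last by rewrite adjC.
  - by rewrite /= !inE !negb_or qr ![_ == u]eq_sym !uB' // ![_ == v]eq_sym vq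
      vr.
  - by apply: memE => z; rewrite !inE; do ![case: (_ == _)].
  - by rewrite /= aqr adjC !uBadj.
have partA := dominating_part AB A0 BA nA.
have partB := dominating_part (subsetDl B A) BA A0' nA'.
case: partA => [[v AE]|[q [r [AE qr aqr aq br]]]];
  case: partB => [[v' BAE]|[q' [r' [BAE qr' aqr' aq' br']]]].
- have vA : v \in A by rewrite AE inE.
  have v'A : v' \in B :\: A by rewrite BAE inE.
  have vB := AB' v vA; have v'B := sub v' v'A; have vv' := neqAB v v' vA v'A.
  have two x y : x \in B -> y \in B -> x != y -> adj a x -> adj b y ->
      B = [set x; y] -> ham_path a b (u |: B).
    move=> xB yB xy ax by_ {}BE; exists x, [:: u; y]; split=> //.
    + by rewrite /= !inE negb_or xy uB' // eq_sym uB'.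
    + by move=> z; rewrite BE !inE; do ![case: (_ == _)].
    + by rewrite /= adjC !uBadj.
    + by rewrite adjC.
  have BE2 : B = [set v; v'] by rewrite {1}BE BAE AE.
  have BE2' : B = [set v'; v] by rewrite setUC.
  have [ca caC aca] := two_cut_nbr cut.
  have [cb cbC bcb] := two_cut_nbr (two_cut_sym cut).
  have caB : ca \in [set v; v'].
    rewrite -BE2; move: caC; rewrite !inE => /orP[/eqP E|//].
    by rewrite E (negbTE nau) in aca.
  have cbB : cb \in [set v; v'].
    rewrite -BE2; move: cbC; rewrite !inE => /orP[/eqP E|//].
    by rewrite E (negbTE nbu) in bcb.
  have attv := dominating_attached vB; have attv' := dominating_attached v'B.
  move: caB cbB; rewrite !inE => /orP[]/eqP Ea /orP[]/eqP Eb;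
    rewrite Ea in aca; rewrite Eb in bcb.
  + have [av'|bv'] := orP attv'; last exact: two BE2.
    by apply: two BE2' => //; rewrite eq_sym.
  + exact: two BE2.
  + by apply: two BE2' => //; rewrite eq_sym.
  + have [av|bv] := orP attv; first exact: two BE2.
    by apply: two BE2' => //; rewrite eq_sym.
- have vA : v \in A by rewrite AE inE.
  have q'A : q' \in B :\: A by rewrite BAE !inE eqxx.
  have r'A : r' \in B :\: A by rewrite BAE !inE eqxx orbT.
  exact: (end1 A (B :\: A) v q' r' AE BAE BE (AB' v vA) (sub _ q'A) (sub _ r'A)
    qr' (neqAB _ _ vA q'A) (neqAB _ _ vA r'A) aqr' aq' br').
- have vA : v' \in B :\: A by rewrite BAE inE.
  have q'A : q \in A by rewrite AE !inE eqxx.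
  have r'A : r \in A by rewrite AE !inE eqxx orbT.
  apply: (end1 (B :\: A) A v' q r BAE AE _ (sub _ vA) (AB' q q'A) (AB' r r'A)
    qr _ _ aqr aq br); first by rewrite setUC.
    by rewrite eq_sym neqAB.
  by rewrite eq_sym neqAB.
- have qA : q \in A by rewrite AE !inE eqxx.
  have rA : r \in A by rewrite AE !inE eqxx orbT.
  have q'A : q' \in B :\: A by rewrite BAE !inE eqxx.
  have r'A : r' \in B :\: A by rewrite BAE !inE eqxx orbT.
  exists q, [:: r; u; q'; r']; split=> //; last by rewrite adjC.
  + have uq := uB' q (AB' q qA); have ur := uB' r (AB' r rA).
    have uq' := uB' q' (sub q' q'A); have ur' := uB' r' (sub r' r'A).
    rewrite /= !inE !negb_or qr qr' (eq_sym q u) uq (eq_sym r u) ur uq' ur'.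
    by rewrite !(neqAB _ _ qA) ?(neqAB _ _ rA).
  + by move=> z; rewrite {1}BE BAE AE !inE; do ![case: (_ == _)].
  + by rewrite /= aqr aqr' adjC uBadj ?AB' //= uBadj ?sub.
Qed.

End NoEnd.
End Dominating.

(** * Hamilton cycles through a two-vertex cut *)

(** When [u] sees neither [a] nor [b], the set [B] may itself be a join; then
[u] can be moved into one of its factors, and both factors have at least two
vertices because no vertex dominates [B]. *)
Lemma dominating_case a b u B : two_cut a b (u |: B) -> u \notin B ->
  join [set u] B -> 0 < #|B| -> ham_path a b (u |: B).
Proof.
move=> cut uB jB B0; have [v vB] := card_gt0P B0.
have uBadj y : y \in B -> adj u y by apply: jB; rewrite inE.
have [au|nau] := boolP (adj a u); have [bu|nbu] := boolP (adj b u).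
- have [w [vw wu nuw]] := private_nbr (uBadj v vB).
  have wC : w \notin u |: B.
    by rewrite !inE negb_or wu; apply: contra nuw; apply: uBadj.
  have vC : v \in u |: B by rewrite !inE vB orbT.
  by case/orP: (tc_nbr cut vC vw wC) => /eqP wE; rewrite wE adjC ?au ?bu in nuw.
- exact: dominating_one_end.
- by apply: ham_path_sym; apply: dominating_one_end => //; apply: two_cut_sym.
have [w [wB wv _]] := dominating_not_complete cut jB nau nbu vB.
have B1 : 1 < #|B| by apply/card_gt1P; exists v, w; split; rewrite // eq_sym.
have P4B : P4_free (@adj G) B.
  move=> x y z t xB yB zB tB.
  by apply: (two_cut_P4_free cut); rewrite inE ?xB ?yB ?zB ?tB orbT.
have [A [spA|[AB A0 BA jA]]] :=
  cograph_split (@adj_sym G) (@adj_irrefl G) P4B B1.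
  exact: (dominating_ham_path cut uB jB nau nbu spA).
have AB' := subsetP AB.
have CE : u |: B = A :|: (u |: (B :\: A)).
  by rewrite setUCA -{1}(setID B A) (setIidPr AB).
have [A1|A1] := leqP #|A| 1.
  have /cards1P[p AE] : #|A| == 1 by rewrite eqn_leq A1 card_gt0.
  have pA : p \in A by rewrite AE inE.
  have [q [qB qp]] := dominating_not_complete cut jB nau nbu (AB' p pA).
  by rewrite jA // inE qB AE inE qp.
rewrite CE in cut *; apply: join_ham_path => //.
  move=> x y xA; rewrite in_setU1 => /orP[/eqP->|]; last exact: jA.
  by rewrite adjC uBadj // AB'.
have [q qBA] := set0Pn _ BA; have qB : q \in B by move: qBA;
  rewrite inE => /andP[].
apply/card_gt1P; exists u, q; rewrite !inE eqxx; split=> //.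
  by move: qBA; rewrite inE => ->; rewrite orbT.
by apply: contraNneq uB => ->.
Qed.

Lemma ham_path_two_cut a b C : two_cut a b C -> ham_path a b C.
Proof.
move=> cut; have [C1|C1] := leqP #|C| 1.
  have [c cC ac] := two_cut_nbr cut.
  have CE : C = [set c] by apply/eqP; rewrite eq_sym eqEcard sub1set cC cards1.
  have [c' c'C bc'] := two_cut_nbr (two_cut_sym cut).
  move: c'C; rewrite CE inE => /eqP E; rewrite E in bc'.
  by exists c, [::]; split=> // [z|]; rewrite ?inE // adjC.
have [A [[AC A0 CA nA]|[AC A0 CA jA]]] :=
    cograph_split (@adj_sym G) (@adj_irrefl G) (two_cut_P4_free cut) C1.
  have [x [y [xA yA xy]]] := two_cut_connected cut AC A0 CA.
  by have := nA x y xA yA; rewrite /anti xy.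
have CE : C = A :|: (C :\: A) by rewrite -{1}(setID C A) (setIidPr AC).
rewrite -!card_gt0 in A0 CA.
have single A' B' : join A' B' -> 0 < #|A'| -> 0 < #|B'| -> #|A'| <= 1 ->
    two_cut a b (A' :|: B') -> ham_path a b (A' :|: B').
  move=> jA' A0' B0' A1' cut'.
  have /cards1P[u AE] : #|A'| == 1 by rewrite eqn_leq A1'.
  rewrite AE in jA' cut' *; apply: dominating_case => //.
  by apply/negP; apply: (join_disjoint jA'); rewrite inE.
rewrite CE in cut *; have [A1|A1] := leqP #|A| 1; first exact: single.
have [B1|B1] := leqP #|C :\: A| 1; last exact: join_ham_path.
rewrite setUC in cut *; apply: single => //; exact: join_sym.
Qed.

Lemma hamiltonian_two_cut a b C : two_cut a b C -> hamiltonian G.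
Proof.
move=> cut; have [x [p [us eC px ax lb]]] := ham_path_two_cut cut.
have [y [q [us' eC' qy by_ la]]] :=
  ham_path_two_cut (two_cut_sym (two_cut_compl cut)).
have [ab aC bC _ _ _] := cut.
exists (a :: (x :: p) ++ b :: (y :: q)); split.
- by rewrite /= size_cat /= !addnS.
- apply/andP; split.
    rewrite /cycle rcons_path cat_path /= ax px lb by_ qy /=.
    by rewrite last_cat.
  have ax' : a \notin x :: p by rewrite eC.
  have ay' : a \notin y :: q by rewrite eC' !inE eqxx orbT.
  have by' : b \notin y :: q by rewrite eC' !inE eqxx !orbT.
  rewrite cons_uniq mem_cat (in_cons b) (negbTE ax') (negbTE ay') (negbTE ab).
  rewrite cat_uniq us cons_uniq by' us' !andbT.
  apply/hasPn => z; rewrite (in_cons b) eC' eC => /orP[/eqP->//|].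
  by rewrite !inE negb_or => /andP[].
- move=> z; rewrite -[a :: _]/([:: a] ++ _) !mem_cat eC (in_cons b) eC' !inE.
  by case: (z \in C); case: (z == a); case: (z == b).
Qed.

(** * Graphs without cuts of at most two vertices *)

Lemma critical_sym u v T f : critical_cut u v T f -> critical_cut v u T f.
Proof.
case=> uT vT nuv fT cT; split=> //; first by rewrite eq_sym.
by move=> x y xT yT xy nxy; apply: fT; rewrite // orbC.
Qed.

(** A critical colouring already has as many colours as 1-toughness permits, so
no colour class can be split further. The last two hypotheses keep the ends of
the edge [uv] in [X], so that gluing their colours is still possible after the
split. *)
Lemma critical_class_connected u v T f x y X : critical_cut u v T f ->
  0 < #|T| -> x \notin T -> y \notin T -> f y = f x -> x \in X -> y \notin X ->
  (f x = f u -> u \in X) -> (f x = f v -> v \in X) ->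
  exists d d', [/\ d \in X, d' \notin X, d \notin T /\ d' \notin T,
    f d = f x /\ f d' = f x & adj d d'].
Proof.
move=> crit T0 xT yT fyx xX yX uX vX; have [uT vT nuv fT cardT] := crit.
suff /existsP[d /existsP[d' /and5P[dX d'X /andP[dT d'T] /andP[/eqP fd /eqP fd']
  dd']]] :
    [exists d, [exists d', [&& d \in X, d' \notin X,
      (d \notin T) && (d' \notin T),
      (f d == f x) && (f d' == f x) & adj d d']]].
  by exists d, d'.
apply: contraT; rewrite negb_exists => /forallP nE.
have {}nE d d' : d \in X -> d \notin T -> d' \notin T -> f d = f x ->
  f d' = f x ->
    adj d d' -> d' \in X.
  move=> dX dT d'T fd fd' dd'; apply: contraT => d'X; have := nE d.
  by rewrite negb_exists => /forallP/(_ d');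
    rewrite dX d'X dT d'T fd fd' eqxx dd'.
(* the class of [x] is split along [X], and the colours of [u] and [v] are
   glued *)
pose h z := if (f z == f x) && (z \notin X) then None else Some (glue f u v z).
have huv : h u = h v.
  rewrite /h /glue eqxx if_same.
  have [/eqP/esym/uX-> | _] := boolP (f u == f x); rewrite ?andbF.
    by have [/eqP/esym/vX-> | _] := boolP (f v == f x); rewrite ?andbF.
  by have [/eqP/esym/vX-> | _] := boolP (f v == f x); rewrite ?andbF.
have hT : locally_const T h.
  move=> z z' zT z'T zz'.
  have [/orP[]/andP[/eqP-> /eqP->]//|nzz'] :=
    boolP ((z == u) && (z' == v) || (z == v) && (z' == u)).
  have fzz' : f z = f z' by apply: fT.
  rewrite /h /glue -fzz'; have [/eqP fzx|//] := boolP (f z == f x).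
  have -> // : (z \in X) = (z' \in X).
  apply/idP/idP => [zX|z'X]; first by apply: (nE z) => //; rewrite -fzz'.
  by apply: (nE z') => //; rewrite -?fzz' // adjC.
have cardh : #|glue f u v @: ~: T|.+1 <= #|h @: ~: T|.
  have Sinj : injective (@Some G) by move=> ? ? [].
  rewrite -(card_imset _ Sinj).
  have -> : #|[set Some z | z in glue f u v @: ~: T]|.+1 =
      #|None |: [set Some z | z in glue f u v @: ~: T]|.
    by rewrite cardsU1; case: imsetP => // [[]].
  apply/subset_leq_card/subsetP => k; rewrite in_setU1 => /orP[/eqP->|].
    by apply/imsetP; exists y; rewrite ?inE // /h fyx eqxx yX.
  case/imsetP=> _ /imsetP[z zT ->] ->; apply/imsetP.
  have [/andP[/eqP fzx zX]|hz] := boolP ((f z == f x) && (z \notin X)).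
    by exists x; rewrite ?inE // /h xX andbF /glue fzx.
  by exists z; rewrite // /h (negbTE hz).
have gtT : #|T| < #|h @: ~: T|.
  by apply: leq_trans cardh; rewrite ltnS -ltnS;
    apply: leq_trans (glue_card f u v _).
by have := tG hT (leq_trans (T0 : 1 < #|T|.+1) gtT); rewrite leqNgt gtT.
Qed.

Section NoTwoCut.
Hypothesis no2 : forall a b C, ~ @two_cut G a b C.

(** A two-element [S] with two colours is a two-vertex cut, one side of which
is the colour class of [x]. *)
Lemma three_connected (K : eqType) S (f : G -> K) x y : #|S| <= 2 ->
  locally_const S f -> x \notin S -> y \notin S -> f x = f y.
Proof.
move=> S2 lcf xS yS; have [S1|S1] := leqP #|S| 1;
  first exact: cut_vertex lcf xS yS.
have /cards2P[a [b [ab SE]]] : #|S| == 2 by rewrite eqn_leq S2.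
apply/eqP; apply: contraT => nfxy.
case: (@no2 a b [set z | (z \notin S) && (f z == f x)]).
have aS : a \in S by rewrite SE !inE eqxx.
have bS : b \in S by rewrite SE !inE eqxx orbT.
split; rewrite ?inE ?aS ?bS //.
- by exists x; rewrite inE xS eqxx.
- exists y; rewrite inE yS /= eq_sym nfxy; split=> //.
    by apply: contraNneq yS => ->.
  by apply: contraNneq yS => ->.
- move=> z w; rewrite !inE => /andP[zS /eqP fz] zw; rewrite negb_and negbK.
  case/orP=> [|fw]; first by rewrite SE !inE.
  apply: contraT => wab; have wS : w \notin S by rewrite SE !inE.
  by rewrite -(lcf z w zS wS zw) fz eqxx in fw.
Qed.

Lemma min_degree v : 2 < #|[set w | adj v w]|.
Proof.
rewrite ltnNge; apply/negP => N2.
have [w] : exists w, w \notin v |: [set w | adj v w].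
  apply/existsP; rewrite -negb_forall; apply: contraL gt3 => /forallP all.
  rewrite -leqNgt; apply: leq_trans (_ : #|v |: [set w | adj v w]| <= _).
    by apply/subset_leq_card/subsetP => w _.
  by rewrite cardsU1; case: (_ \notin _); rewrite ?add1n ?add0n // ltnW.
rewrite !inE negb_or => /andP[wv nvw].
have : (v == v) = (w == v).
  apply: (three_connected (S := [set w | adj v w]) (f :=
    fun x => x == v)) => //.
  - move=> x y; rewrite !inE => nx ny xy; apply/eqP/eqP => E; subst.
      by rewrite xy in ny.
    by rewrite adjC xy in nx.
  - by rewrite inE adj_irrefl.
  - by rewrite inE.
by rewrite eqxx (negbTE wv).
Qed.

(** A smaller [T] has at most one vertex, and the bridge [uv] of [G - T] then
makes [T] together with [u] or with [v] a cut with at most two vertices. *)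
Lemma critical_size u v T f : adj u v -> critical_cut u v T f -> 2 < #|T|.
Proof.
move=> uv crit; have [uT vT nuv fT cardT] := crit; rewrite ltnNge;
  apply/negP => T2.
have glue1 : #|glue f u v @: ~: T| <= 1.
  rewrite leqNgt; apply/negP =>
    /card_gt1P[_ [_ [/imsetP[x xT ->] /imsetP[y yT ->]]]].
  rewrite !inE in xT yT.
  by rewrite (three_connected T2 (glue_lc crit) xT yT) eqxx.
have T1 : #|T| <= 1.
  rewrite -ltnS; apply: leq_trans cardT _;
    apply: leq_trans (glue_card f u v _) _.
  by [].
have addT z : z \in [set u; v] -> locally_const (z |: T) f.
  move=> zuv x y; rewrite !inE !negb_or => /andP[xz xT] /andP[yz yT] xy.
  apply: fT => //; apply/negP => /orP[]/andP[/eqP xE /eqP yE]; move: zuv xz yz;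
    by rewrite xE yE !inE => /orP[]/eqP->; rewrite eqxx.
have card_addT z : #|z |: T| <= 2.
  by rewrite cardsU1; case: (_ \notin _); rewrite ?add1n ?add0n // ltnW.
have [w] : exists w, w \notin u |: (v |: T).
  apply/existsP; rewrite -negb_forall; apply: contraL gt3 => /forallP all.
  rewrite -leqNgt; apply: leq_trans (_ : #|u |: (v |: T)| <= _).
    by apply/subset_leq_card/subsetP => w _.
  by rewrite cardsU1; case: (_ \notin _);
    rewrite ?add1n ?add0n ?ltnS ?card_addT // ltnW ?ltnS.
rewrite !inE !negb_or => /and3P[wu wv wT].
have uv' := adj_neq uv.
have fwv : f w = f v.
  apply: (three_connected (card_addT u) (addT u _)); rewrite ?inE ?eqxx //.
    by rewrite negb_or wu.
  by rewrite negb_or eq_sym uv'.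
have fwu : f w = f u.
  apply: (three_connected (card_addT v) (addT v _));
    rewrite ?inE ?eqxx ?orbT //.
    by rewrite negb_or wv.
  by rewrite negb_or uv'.
by rewrite -fwu -fwv eqxx in nuv.
Qed.

Lemma critical_other_class u v T f : critical_cut u v T f -> 2 < #|T| ->
  exists w, [/\ w \notin T, f w != f u & f w != f v].
Proof.
case=> uT vT nuv fT cardT T2.
suff /existsP[w /and3P[]] :
  [exists w, [&& w \notin T, f w != f u & f w != f v]] by exists w.
apply: contraT; rewrite negb_exists => /forallP nW.
have : #|f @: ~: T| <= #|[set f u; f v]|.
  apply/subset_leq_card/subsetP => _ /imsetP[w wT ->]; rewrite inE in wT.
  by have := nW w; rewrite wT !inE -negb_or negbK.
by rewrite cards2 nuv leqNgt (leq_trans _ cardT) // ltnW.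
Qed.

(** If [u] did not dominate its component, there would be an edge [d d'] with
[d] a neighbour of [u] and [d'] not, and [v u d d'] would be an induced [P4],
isolated from any other component. *)
Lemma critical_leaf_pendant u v T f :
  adj u v -> critical_cut u v T f -> 2 < #|T| ->
  (forall y, y \notin T -> f y = f v -> y = v) ->
  pendant T u v [set w | (w \notin T) && ((f w == f u) || (f w == f v))] f.
Proof.
move=> uv crit T2 leaf; have [uT vT nuv fT cardT] := crit.
have vu : v != u by rewrite eq_sym (adj_neq uv).
have leafN w : adj v w -> w != u -> w \in T.
  move=> vw wu; apply: contraT => wT; have wv : w = v.
    apply: (leaf w wT); apply: (fT w v wT vT); first by rewrite adjC.
    by rewrite (negbTE wu) (negbTE vu) andbF.
  by rewrite wv adj_irrefl in vw.
have fTM x y : x \notin T -> y \notin T -> adj x y ->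
    ~~ ((f x == f u) || (f x == f v)) -> f x = f y.
  move=> xT yT xy; rewrite negb_or => /andP[xu xv]; apply: fT => //.
  by apply/negP => /orP[]/andP[/eqP E _];
    [rewrite E eqxx in xu | rewrite E eqxx in xv].
have [e [eT eu ev]] := critical_other_class crit T2.
have nadj_e x : x \notin T -> (f x == f u) || (f x == f v) -> ~~ adj x e.
  move=> xT fx; apply/negP; rewrite adjC => ex.
  have := fTM e x eT xT ex; rewrite negb_or eu ev => /(_ isT) E.
  by rewrite -E (negbTE eu) (negbTE ev) in fx.
split=> //.
- by rewrite inE uT eqxx.
- by rewrite inE vT eqxx orbT.
- by move=> w; rewrite inE => /andP[].
- move=> w; rewrite inE => /andP[wT fw] wu; have [wv|wv] := eqVneq w v;
    first by rewrite wv.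
  have {}fw : f w = f u.
    by case/orP: fw => /eqP // /(leaf w wT) E; rewrite E eqxx in wv.
  apply: contraT => nuw.
  pose X := u |: [set z | adj u z].
  have [||||d [d' [dX d'X [dT d'T] [fd fd'] dd']]] :=
    critical_class_connected crit (ltnW (ltnW T2)) uT wT fw (_ : u \in X) _ _ _.
  + by rewrite !inE eqxx.
  + by rewrite !inE negb_or wu.
  + by rewrite !inE eqxx.
  + by move=> E; rewrite E eqxx in nuv.
  move: d'X; rewrite !inE negb_or => /andP[d'u nud'].
  have du : d != u by apply: contraNneq nud' => <-.
  have ud : adj u d by move: dX; rewrite !inE (negbTE du).
  have nvd : ~~ adj v d by apply: contra dT => vd; apply: leafN.
  have nvd' : ~~ adj v d' by apply: contra d'T => vd'; apply: leafN.
  case: (freeG (_ : adj v u) ud dd' nvd nvd' nud' (nadj_e _ vT _) (nadj_e _ uT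
    _) (nadj_e _ dT _) (nadj_e _ d'T _));
    by rewrite ?fd ?fd' ?eqxx ?orbT // adjC.
- move=> w z; rewrite !inE => /andP[wT fw] wz zT; rewrite zT /=;
    apply: contraT => fz.
  by have := fTM z w zT wT; rewrite adjC => /(_ wz fz) E; rewrite E fw in fz.
- move=> x y; rewrite !inE !negb_or => /andP[xT];
    rewrite xT /= => fx /andP[yT _] xy.
  by apply: fTM; rewrite // negb_or.
- rewrite -ltnS; apply: leq_trans cardT _; set M := [set w | _].
  have sub : (f @: ~: T) \subset [set f u; f v] :|: (f @: ~: (T :|: M)).
    apply/subsetP => _ /imsetP[w wT ->]; rewrite in_setU; rewrite inE in wT.
    have [//|fw] := boolP (f w \in [set f u; f v]); apply: imset_f.
    by rewrite !inE wT /= negb_or wT; rewrite !inE in fw; rewrite fw.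
  apply: leq_trans (subset_leq_card sub) _;
    apply: leq_trans (leq_card_setU _ _) _.
  by rewrite cards2 nuv.
Qed.

(** If both ends of the bridge [uv] had further neighbours [a'] and [b'] in
their component, [a' u v b'] would be an induced [P4], isolated from any other
component. *)
Lemma pendant_exists u v : adj u v ->
  exists S M g, pendant S u v M g \/ pendant S v u M g.
Proof.
move=> uv; have [T [f crit]] := critG uv; have T2 := critical_size uv crit.
have vu : adj v u by rewrite adjC.
have [uT vT nuv fT cardT] := crit.
have [/existsP[y /and3P[yT /eqP fy yv]]|nv] :=
    boolP [exists y, [&& y \notin T, f y == f v & y != v]]; last first.
  do 3!eexists; left; apply: critical_leaf_pendant crit T2 _ => // y yT fy.
  by apply/eqP; apply: contraNT nv => yv; apply/existsP; exists y;
    rewrite yT fy eqxx.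
have [/existsP[x /and3P[xT /eqP fx xu]]|nu] :=
    boolP [exists x, [&& x \notin T, f x == f u & x != u]]; last first.
  do 3!eexists; right; apply: critical_leaf_pendant (critical_sym crit) T2 _ =>
    // x xT fx.
  by apply/eqP; apply: contraNT nu => xu; apply/existsP; exists x;
    rewrite xT fx eqxx.
have T0 : 0 < #|T| by apply: ltnW (ltnW T2).
have [|||b [b' [/set1P-> b'v [_ b'T] [_ fb'] vb']]] :=
  critical_class_connected crit T0 vT yT fy (set11 v) _ _ _; rewrite ?inE //.
  by move=> E; rewrite E eqxx in nuv.
have [|||a [a' [/set1P-> a'u [_ a'T] [_ fa'] ua']]] :=
  critical_class_connected crit T0 uT xT fx (set11 u) _ _ _; rewrite ?inE //.
  by move=> E; rewrite E eqxx in nuv.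
rewrite !inE in b'v a'u; have [e [eT eu ev]] := critical_other_class crit T2.
have nadj p q : p \notin T -> q \notin T -> f p != f q -> p != u ->
  p != v -> ~~ adj p q.
  move=> pT qT npq pu pv; apply: contra npq => pq; apply/eqP/fT => //.
  by rewrite (negbTE pu) (negbTE pv).
have eu' : e != u by apply: contraNneq eu => ->.
have ev' : e != v by apply: contraNneq ev => ->.
have a'v : a' != v by apply: contraNneq nuv => <-; rewrite fa'.
have b'u : b' != u by apply: contraNneq nuv => <-; rewrite fb'.
case: (@freeG a' u v b' e).
- by rewrite adjC.
- by [].
- by [].
- by apply: nadj; rewrite // fa'.
- by apply: nadj; rewrite // fa' fb'.
- by rewrite adjC; apply: nadj; rewrite // fb' eq_sym.
- by rewrite adjC; apply: nadj; rewrite // fa'.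
- by rewrite adjC; apply: nadj.
- by rewrite adjC; apply: nadj.
- by rewrite adjC; apply: nadj; rewrite // fb'.
Qed.

(** The leaf [v] has degree at least three and only one neighbour in [M]. *)
Lemma pendant_leaf_degree S u v M g :
  pendant S u v M g -> 1 < #|[set w in S | adj v w]|.
Proof.
move=> pd; have := min_degree v; rewrite ltnNge => nle.
rewrite ltnNge; apply: contra nle => le1.
apply: leq_trans (_ : #|u |: [set w in S | adj v w]| <= _).
  apply/subset_leq_card/subsetP => w; rewrite !inE => vw.
  by have [//|wu] := eqVneq w u; rewrite vw (pd_leaf pd vw wu).
by rewrite cardsU1; case: (_ \notin _); rewrite ?add1n ?add0n // ltnW.
Qed.

Lemma pendant_far S u v M g w z : pendant S u v M g ->
  w \in M -> z \notin S :|: M -> ~~ adj w z.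
Proof.
move=> pd wM; rewrite inE negb_or => /andP[zS zM].
by apply: contra zM => wz; apply: (pd_closed pd wM wz).
Qed.

(** Say that [s] sees [u] but not [v]. A neighbour [d] of [s] outside [S] and
[M] yields an induced path [d s u v], so [s] is adjacent to every vertex in
components other than the one of [d]. As there are at least two such
components, [s] is adjacent to all of them. *)
Lemma pendant_complete S u v M g s c : pendant S u v M g -> s \in S ->
  adj s u != adj s v -> c \notin S :|: M -> adj s c.
Proof.
move=> pd sS suv cO; have far := pendant_far pd.
have [uM vM] := (pd_uM pd, pd_vM pd).
have uS := pd_MS pd uM.
(* s reaches beyond M, since otherwise removing S :\ s would leave #|S|
   components *)
have [c0 c0O sc0] : exists2 c0, c0 \notin S :|: M & adj s c0.
  apply/exists_inP; apply: contraT; rewrite negb_exists_in => /forall_inP nsO.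
  (* without [s], the vertices of [M] and [S] cannot be reached from outside *)
  pose h z := if z \in S :|: M then None else Some (g z).
  have lch : locally_const (S :\ s) h.
    suff main x y : x \notin S :\ s -> y \notin S :\ s -> adj x y ->
        x \notin S :|: M -> y \notin S :|: M.
      move=> x y xS yS xy; rewrite /h.
      have [xO|xO] := boolP (x \in S :|: M);
        have [yO|yO] := boolP (y \in S :|: M) => //.
      - by have := main y x yS xS; rewrite adjC xO yO => /(_ xy isT).
      - by have := main x y xS yS xy xO; rewrite yO.
      - by congr Some; apply: (pd_lc pd).
    move=> _ yS xy xO; have ys : y != s.
      by apply: contraTneq xy => ->; rewrite adjC; apply: nsO.
    apply: contraL xy; rewrite inE => /orP[yS'|yM];
      first by rewrite !inE ys yS' in yS.
    by rewrite adjC; apply: far.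
  have cardh : #|S| <= #|h @: ~: (S :\ s)|.
    apply: leq_trans (pd_card pd) _; rewrite -addn1 -(cards1 (h u)) -imset_set1.
    apply: leq_trans (_ : #|h @: ~: (S :|: M)| + #|h @: [set u]| <= _).
      rewrite leq_add2r; apply: leq_colors => x y; rewrite !in_setC => xO yO.
      by rewrite /h (negbTE xO) (negbTE yO) => -[].
    apply: leq_colorsU.
    + by rewrite setCS; apply: subset_trans (subsetDl _ _) (subsetUl _ _).
    + by rewrite sub1set !inE (negbTE uS) andbF.
    + by move=> x y; rewrite in_setC => xO /set1P->;
        rewrite /h (negbTE xO) inE uM orbT.
  have := tG lch (leq_trans (ltnW (pd_size pd)) cardh).
  by rewrite leqNgt (leq_trans _ cardh) // [X in _ < X](cardsD1 s S) sS add1n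
    ltnS.
have other d e : d \notin S :|: M -> e \notin S :|: M -> adj s d ->
  g d != g e -> adj s e.
  move=> dO eO sd gde; apply: contraT => nse.
  have nde : ~~ adj d e by apply: contra gde => de; apply/eqP/(pd_lc pd).
  have du : ~~ adj d u by rewrite adjC; apply: far.
  have dv : ~~ adj d v by rewrite adjC; apply: far.
  have ue : ~~ adj u e by apply: far.
  have ve : ~~ adj v e by apply: far.
  have ds : adj d s by rewrite adjC.
  have uv := pd_adj pd; have vu : adj v u by rewrite adjC.
  move: suv; case: (boolP (adj s u)) => su; case: (boolP (adj s v)) => sv // _.
    by case: (freeG ds su uv du dv sv nde nse ue ve).
  by case: (freeG ds sv vu dv du su nde nse ve ue).
have [c1 c1O gc1] : exists2 c1, c1 \notin S :|: M & g c0 != g c1.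
  have /card_gt1P[_ [_ [/imsetP[x xO ->] /imsetP[y yO ->] nxy]]] :
    1 < #|g @: ~: (S :|: M)|.
    by rewrite -ltnS; apply: leq_trans (pd_size pd) (pd_card pd).
  rewrite in_setC in xO; rewrite in_setC in yO.
  have [gx|gx] := eqVneq (g c0) (g x); last by exists x.
  by exists y; rewrite // gx.
have [gc|gc] := eqVneq (g c0) (g c); last exact: other sc0 gc.
by apply: (other c1) => //; [apply: other sc0 gc1 | rewrite -gc eq_sym].
Qed.

Lemma card_outside S u v M g : pendant S u v M g -> #|S| <= #|~: (S :|: M)|.+1.
Proof. by move=> pd; apply: leq_trans (pd_card pd) _;
  rewrite ltnS leq_imset_card. Qed.

Section Step.
Variables (S : {set G}) (u v : G) (M : {set G}) (g : G -> G).
Hypothesis pd : pendant S u v M g.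
Let O := ~: (S :|: M).

Let uv : adj u v. Proof. exact: pd_adj pd. Qed.
Let uM : u \in M. Proof. exact: pd_uM pd. Qed.
Let vM : v \in M. Proof. exact: pd_vM pd. Qed.
Let MS w : w \in M -> w \notin S. Proof. exact: (pd_MS pd). Qed.
Let inO c : c \in O -> c \notin S :|: M. Proof. by rewrite inE. Qed.
Let notO z : z \notin O -> z \in S \/ z \in M.
Proof. by rewrite !inE negbK => /orP. Qed.
Let farO w c : w \in M -> c \in O -> ~~ adj w c.
Proof. by move=> wM /inO; apply: (pendant_far pd). Qed.

Variable x : G.
Hypotheses (vx : adj v x) (xu : x != u) (nux : ~~ adj u x).

Let xS : x \in S. Proof. exact: (pd_leaf pd vx xu). Qed.
Let xO c : c \in O -> adj x c.
Proof.
move=> /inO; apply: (pendant_complete pd xS).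
by rewrite ![adj x _]adjC vx (negbTE nux).
Qed.

Let degv : #|[set w in S | adj v w]| = #|[set w in S :\ x | adj v w]|.+1.
Proof.
rewrite (cardsD1 x) inE xS vx add1n; congr _.+1; apply: eq_card => w.
by rewrite !inE andbA.
Qed.

Let card_far (X : {set G}) : X \subset S -> (forall z, z \in X -> ~~ adj v z) ->
  #|X| + #|[set w in S | adj v w]| <= #|S|.
Proof.
move=> XS nX; rewrite -(cardsID X S) (setIidPr XS) leq_add2l.
apply/subset_leq_card/subsetP => w; rewrite !inE => /andP[-> vw]; rewrite andbT.
by apply: contraTN vw; apply: nX.
Qed.

(** Suppose [x] is the leaf and [v] the centre. Then [T] contains [O], since
[x] dominates [O], and the vertices outside [T] and [M'] are joined to [O], so
they lie in [S] and miss [v]. Counting leaves only [T = O], and then every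
neighbour of [u] is one of [v], against [private_nbr]. *)
Lemma private_nbr_not_leaf T M' g' : ~ pendant T v x M' g'.
Proof.
move=> pd'; set O' := ~: (T :|: M').
have inO' z : z \in O' -> z \notin T :|: M' by rewrite inE.
have farO' w c : w \in M' -> c \in O' -> ~~ adj w c.
  by move=> wM /inO'; apply: (pendant_far pd').
have OT c : c \in O -> c \in T.
  move=> cO; apply: (pd_leaf pd' (xO cO)).
  by apply: contraTneq cO => ->; rewrite !inE vM orbT.
have OO' c z : c \in O -> z \in O' -> adj c z.
  move=> cO /inO'; apply: (pendant_complete pd' (OT c cO)).
  by rewrite ![adj c _]adjC xO // (negbTE (farO vM cO)).
have vM' := pd_uM pd'.
have /card_gt0P[c0 c0O] : 0 < #|O|.
  by rewrite -ltnS; apply: leq_trans (card_outside pd);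
    apply: ltnW (pd_size pd).
have O'S : O' \subset S.
  apply/subsetP => z zO'; have [|//|zM] := @notO z.
    by apply: contraTN (zO') => zO; rewrite !inE (OT z zO).
  by have := farO zM c0O; rewrite adjC OO'.
have cardO' := card_far O'S (fun z => farO' v z vM').
have OsubT : O \subset T by apply/subsetP.
have leOT := subset_leq_card OsubT.
have cS := card_outside pd; have cT := card_outside pd'.
have deg2 := pendant_leaf_degree pd.
have TE : O = T.
  apply/eqP; rewrite eqEcard OsubT -/O -/O' in cS cT *.
  by clear - cardO' leOT cS cT deg2; lia.
have uT : u \notin T by rewrite -TE !inE uM orbT.
have vu : adj v u by rewrite adjC.
have uM' : u \in M' by apply: (pd_closed pd' vM' vu).
have [w [uw wv nvw]] := private_nbr vu.
case/negP: nvw; apply: (pd_center pd') => //; apply: (pd_closed pd' uM' uw).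
by rewrite -TE; apply: contraTN uw; apply: farO.
Qed.

(** The remaining vertices [O'] outside [T] and [M'] are neighbours of [u]. If
one of them is in [S], it is joined to [O], so [O] lies in [T] and [O'] in [S],
and [T] is too large for its number of components. So [O'] lies in [M]. Let [Q]
be the part of [T] in [M - u - v]. Removing [S], [u] and [Q] separates [v], the
components in [O], and those in [O']; the count is so tight that [T] has
exactly one vertex [z] in [S] and that [O'] is all of [M - u - v - Q]. The
vertices of [O'] need private neighbours against [u], and [z] is the only
candidate. *)
Lemma private_nbr_leaf T M' g' : pendant T x v M' g' -> exists z P Q,
  [/\ P = (M :\ u :\ v) :\: Q, Q \subset M :\ u :\ v, #|Q| < #|P|,
      forall d, d \in P -> adj z d && ~~ adj x d
    & [/\ adj v z, z != u, ~~ adj u z &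
          forall y, y \in S -> adj v y -> y != x -> y = z]].
Proof.
move=> pd'; set O' := ~: (T :|: M').
have inO' z : z \in O' -> z \notin T :|: M' by rewrite inE.
have farO' w c : w \in M' -> c \in O' -> ~~ adj w c.
  by move=> wM /inO'; apply: (pendant_far pd').
have notO' z : z \notin O' -> z \in T \/ z \in M' by rewrite !inE negbK => /orP.
have [xM' vM'] := (pd_uM pd', pd_vM pd').
have vu : adj v u by rewrite adjC.
have uT : u \in T by apply: (pd_leaf pd' vu); rewrite eq_sym.
have vT := pd_MS pd' vM'.
have uO' z : z \in O' -> adj u z.
  by move=> /inO'; apply: (pendant_complete pd' uT); rewrite (negbTE nux) uv.
have OO' c : c \in O -> c \notin O' by move=> cO; apply: contraTN (xO cO);
  apply: farO'.
have O'O z : z \in O' -> z \in S \/ z \in M.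
  by move=> zO'; apply: notO; apply: contraTN zO' => /OO'.
have /card_gt0P[c0 c0O] : 0 < #|O|.
  by rewrite -ltnS; apply: leq_trans (card_outside pd);
    apply: ltnW (pd_size pd).
have /card_gt0P[z0 z0O'] : 0 < #|O'|.
  by rewrite -ltnS; apply: leq_trans (card_outside pd');
    apply: ltnW (pd_size pd').
have cS := card_outside pd; have cT := card_outside pd'.
have deg2 := pendant_leaf_degree pd.
have NvT w : w \in [set w in S :\ x | adj v w] -> w \in T.
  by rewrite !inE => /andP[/andP[wx _] vw]; apply: (pd_leaf pd' vw).
have OTO' c z : c \in O -> c \in T -> z \in O' -> adj c z.
  move=> cO cT' /inO'; apply: (pendant_complete pd' cT').
  by rewrite ![adj c _]adjC xO // (negbTE (farO vM cO)).
have [/existsP[z /andP[zO' zS]]|nS] :=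
  boolP [exists z, (z \in O') && (z \in S)].
  have zO c : c \in O -> adj z c.
    move=> /inO; apply: (pendant_complete pd zS).
    by rewrite ![adj z _]adjC uO' // (negbTE (farO' v z vM' zO')).
  have OT c : c \in O -> c \in T.
    move=> cO; have [//|cM'] := notO' c (OO' c cO).
    by have := farO' c z cM' zO'; rewrite adjC zO.
  have O'S : O' \subset S.
    apply/subsetP => d dO'; have [//|dM] := O'O d dO'.
    by have := farO dM c0O; rewrite adjC (OTO' c0 d c0O (OT _ c0O) dO').
  have cardO' := card_far O'S (fun z => farO' v z vM').
  have cardT : #|O| + #|[set w in S :\ x | adj v w]|.+1 <= #|T|.
    have -> : #|[set w in S :\ x | adj v w]|.+1 = #|u |: [set w in S :\ x | adj
      v w]|.
      by rewrite cardsU1 !inE (negbTE (MS uM)) andbF.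
    rewrite -(cardsID O T); apply: leq_add; apply/subset_leq_card/subsetP => w.
      by move=> wO; rewrite inE OT.
    rewrite in_setU1 in_setD => /orP[/eqP->|wN];
      first by rewrite uT andbT !inE uM orbT.
    rewrite (NvT w wN) andbT; move: wN; rewrite !inE => /andP[/andP[_ ->]].
    by [].
  by exfalso; rewrite -/O -/O' in cS cT; clear - cardO' cardT cS cT deg2 degv;
    lia.
have O'M z : z \in O' -> z \in M.
  by move=> zO'; have [zS|//] := O'O z zO'; case/negP: nS; apply/existsP;
    exists z; rewrite zO'.
have OT c : c \in O -> c \notin T.
  move=> cO; apply/negP => cT'; have := farO (O'M z0 z0O') cO.
  by rewrite adjC (OTO' c z0).
set D := M :\ u :\ v; pose Q := T :&: D.
have O'D : O' \subset D.
  apply/subsetP => z zO'; rewrite !inE O'M // andbT; apply/andP; split.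
    by apply: contraTneq zO' => ->; rewrite !inE vM' orbT.
  by apply: contraTneq zO' => ->; rewrite !inE uT.
have O'Q z : z \in O' -> z \notin Q by move=> /inO';
  rewrite !inE negb_or => /andP[/negbTE->].
have DM z : z \in D -> z \in M by rewrite !inE => /and3P[].
have DP z : z \in D -> [/\ z != u,
  z != v & z \in M] by rewrite !inE => /and3P[].
have TE : #|T| = #|T :&: S| + #|Q|.+1.
  have -> : #|Q|.+1 = #|u |: Q| by rewrite cardsU1 !inE eqxx !andbF.
  rewrite -(cardsID S T); congr (_ + _); apply: eq_card => z; rewrite !inE.
  have [->|zu] /= := eqVneq z u; first by rewrite uT MS.
  have [->|zv] /= := eqVneq z v; first by rewrite (negbTE vT) andbF.
  have [zT|//] /= := boolP (z \in T); last by rewrite andbF.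
  rewrite andbT; have [zS|zS] := boolP (z \in S);
    first by apply/esym/negbTE/negP => /MS; rewrite zS.
  by have [|zS'|->//] := @notO z; [apply: contraTN zT;
    apply: OT | rewrite zS' in zS].
(* the components of [G - S'] are [{v}], those of [O], and parts of [D - Q] *)
pose S' := S :|: (u |: Q).
pose rest := D :\: Q :\: O'.
pose h z : option G + option G :=
  if z == v then inl None else if z \in O then inl (Some (g z))
  else if z \in O' then inr (Some (g' z)) else inr None.
have cases z : z \notin S' -> [\/ z = v, z \in O | z \in D :\: Q].
  move=> zS'; have [zS zu zQ] : [/\ z \notin S, z != u & z \notin Q].
    by move: zS'; rewrite in_setU in_setU1 !negb_or => /and3P[].
  have [->|zv] := eqVneq z v; first by constructor 1.
  have [zO|zO] := boolP (z \in O); first by constructor 2.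
  have zM : z \in M by have [zS2|//] := notO zO; rewrite zS2 in zS.
  by constructor 3; rewrite in_setD zQ !inE zu zv zM.
have vO : v \notin O by rewrite !inE vM orbT.
have vO' : v \notin O' by rewrite !inE vM' orbT.
have DO z : z \in D -> z \notin O by move=> /DM zM; rewrite !inE zM orbT.
have restM' z : z \in D :\: Q -> z \notin O' -> z \in M'.
  rewrite inE => /andP[zQ zD] /notO'[zT|//].
  by case/negP: zQ; rewrite inE zT.
have lch : locally_const S' h.
  have vfar z : z \notin S' -> ~~ adj v z.
    rewrite !inE !negb_or => /and3P[zS zu _]; apply: contra zS => vz.
    exact: (pd_leaf pd).
  move=> y z yS' zS' yz.
  have [yE|yO|yD] := cases y yS'; first by rewrite yE in yz;
    case/negP: (vfar z zS').
    have [zE|zO|zD] := cases z zS'.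
    - by rewrite zE adjC in yz; case/negP: (vfar y yS').
    - have nv c : c \in O -> c == v = false by move=> cO;
        apply: contraTF cO => /eqP->.
      rewrite /h yO zO !nv //; congr (inl (Some _)).
      by apply: (pd_lc pd); [apply: inO | apply: inO |].
    - by have := farO (DM z (subsetP (subsetDl _ _) z zD)) yO; rewrite adjC yz.
  have yD' := subsetP (subsetDl _ _) y yD.
  have [zE|zO|zD] := cases z zS'.
  - by rewrite zE adjC in yz; case/negP: (vfar y yS').
  - by have := farO (DM y yD') zO; rewrite yz.
  have zD' := subsetP (subsetDl _ _) z zD.
  have [_ /negbTE yv _] := DP y yD'; have [_ /negbTE zv _] := DP z zD'.
  rewrite /h yv zv (negbTE (DO y yD')) (negbTE (DO z zD')).
  have [yO'|yO'] := boolP (y \in O'); have [zO'|zO'] := boolP (z \in O') => //.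
  - by congr (inr (Some _)); apply: (pd_lc pd'); [apply: inO' | apply: inO' |].
  - by have := farO' z y (restM' z zD zO') yO'; rewrite adjC yz.
  - by have := farO' y z (restM' y yD yO') zO'; rewrite yz.
have cardS' : #|S'| <= #|S| + #|Q|.+1.
  apply: leq_trans (leq_card_setU _ _) _; rewrite leq_add2l cardsU1.
  by case: (_ \notin _).
have nonS' z : z \in O \/ z = v \/ z \in D :\: Q -> z \in ~: S'.
  rewrite in_setC in_setU in_setU1 !negb_or => -[zO|[->|]].
  - apply/and3P; split.
    + by move/inO: zO; rewrite in_setU negb_or => /andP[].
    + by apply: contraTneq zO => ->; rewrite !inE uM orbT.
    + by apply: contraTN zO; rewrite in_setI => /andP[_ /DO].
  - by rewrite MS // [v == u]eq_sym adj_neq // in_setI (negbTE vT).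
  - by rewrite in_setD => /andP[zQ /DP[zu _ zM]]; rewrite MS // zu zQ.
have hO : #|g @: O| <= #|h @: O|.
  apply: leq_colors => y z yO zO; rewrite /h yO zO.
  have nv c : c \in O -> c == v = false by move=> cO;
    apply: contraTF cO => /eqP->.
  by rewrite !nv // => -[].
have hO' : #|g' @: O'| <= #|h @: O'|.
  apply: leq_colors => y z yO' zO'; have yD := subsetP O'D y yO';
    have zD := subsetP O'D z zO'.
  have [_ /negbTE yv _] := DP y yD; have [_ /negbTE zv _] := DP z zD.
  by rewrite /h yv zv (negbTE (DO y yD)) (negbTE (DO z zD)) yO' zO' => -[].
have hrest : #|rest| != 0 -> 0 < #|h @: rest|.
  by rewrite -lt0n => /card_gt0P[r rR]; apply/card_gt0P; exists (h r);
    apply: imset_f.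
have O'DQ z : z \in O' -> z \in D :\: Q by move=> zO';
  rewrite inE O'Q // (subsetP O'D).
have tagO y : y \in O -> h y = inl (Some (g y)).
  by move=> yO; rewrite /h yO; case: eqP => // E; rewrite -E yO in vO.
have tagO' y : y \in O' -> h y = inr (Some (g' y)).
  move=> yO'; have yD := subsetP O'D y yO'; have [_ /negbTE yv _] := DP y yD.
  by rewrite /h yv (negbTE (DO y yD)) yO'.
have tagR y : y \in rest -> h y = inr None.
  rewrite inE => /andP[yO']; rewrite inE => /andP[_ yD];
    have [_ /negbTE yv _] := DP y yD.
  by rewrite /h yv (negbTE (DO y yD)) (negbTE yO').
have colors : 1 + #|g @: O| + #|g' @: O'| + (#|rest| != 0) <= #|h @: ~: S'|.
  have h1 : #|h @: [set v]| + #|h @: O| <= #|h @: (v |: O)|.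
    apply: leq_colorsU; rewrite ?subsetUl ?subsetUr // => y z /set1P-> zO.
    by rewrite (tagO z) // /h eqxx.
  have h2 : #|h @: O'| + #|h @: rest| <= #|h @: (D :\: Q)|.
    apply: leq_colorsU; first by apply/subsetP.
      exact: subsetDl.
    by move=> y z yO' zR; rewrite tagO' // tagR.
  have h3 : #|h @: (v |: O)| + #|h @: (D :\: Q)| <= #|h @: ~: S'|.
    apply: leq_colorsU.
    - by apply/subsetP => y; rewrite in_setU1 => /orP[/eqP->|yO];
        apply: nonS'; auto.
    - by apply/subsetP => y yD; apply: nonS'; auto.
    - move=> y z yv zD; have [k ->] : exists k, h z = inr k.
        have [zO'|zO'] := boolP (z \in O'); first by eexists; apply: tagO'.
        by eexists; apply: tagR; rewrite inE zO'.
      by move: yv; rewrite in_setU1 => /orP[/eqP->|/tagO->//]; rewrite /h eqxx.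
  rewrite imset_set1 cards1 in h1.
  have h4 : (#|rest| != 0) <= #|h @: rest| by move: hrest;
    case: eqP => // _ /(_ isT).
  rewrite -addnA; apply: leq_trans h3; apply: leq_add.
    by apply: leq_trans h1; rewrite leq_add2l.
  by apply: leq_trans h2; apply: leq_add.
have toughS' : #|h @: ~: S'| <= #|S'|.
  apply: tG lch _; apply: leq_trans colors.
  by have := pd_card pd; have := pd_size pd; rewrite -/O; clear; lia.
have cS' := pd_card pd; have cT' := pd_card pd'; rewrite -/O -/O' in cS' cT'.
have N0 : 0 < #|[set w in S :\ x | adj v w]| by rewrite degv in deg2.
have NTS : [set w in S :\ x | adj v w] \subset T :&: S.
  apply/subsetP => w wN; rewrite inE NvT //.
  by move: wN; rewrite !inE => /andP[/andP[]].
have leN := subset_leq_card NTS.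
have TS1 : #|T :&: S| + (#|rest| != 0) <= 1.
  by clear - colors toughS' cS' cT' TE cardS'; lia.
have rest0 : #|rest| = 0.
  apply/eqP; move: TS1; case: eqP => //= _.
  by rewrite addn1 ltnS leqNgt (leq_trans N0 leN).
have /cards1P[z zE] : #|T :&: S| == 1.
  by rewrite eqn_leq (leq_trans N0 leN) andbT; move: TS1; rewrite rest0 addn0.
have NE w : w \in S -> w != x -> adj v w -> w = z.
  move=> wS wx vw; apply/set1P; rewrite -zE; apply: (subsetP NTS).
  by rewrite !inE wx wS.
have [w0 w0N] := card_gt0P N0.
have [w0S w0x vw0] : [/\ w0 \in S, w0 != x & adj v w0].
  by move: w0N; rewrite !inE => /andP[/andP[]].
have w0z := NE w0 w0S w0x vw0; rewrite w0z in w0S w0x vw0.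
have zd d : d \in O' -> adj z d /\ ~~ adj u z.
  move=> dO'; have [w [dw wu nuw]] := private_nbr (uO' d dO').
  have wM : w \notin M by apply: contra nuw => wM; apply: (pd_center pd).
  have wS : w \in S.
    have [|//|wM'] := @notO w; last by rewrite wM' in wM.
    by apply: contraTN dw; apply: farO (O'M d dO').
  have wT : w \in T.
    have [|//|wM'] := notO' w; first by apply: contra wM; apply: O'M.
    by have := farO' w d wM' dO'; rewrite adjC dw.
  by have : w \in [set z]; [rewrite -zE inE wT | move=> /set1P <-;
    rewrite adjC].
have DQO' d : d \in D :\: Q -> d \in O'.
  move=> dDQ; apply: contraT => dO'; have : d \in rest by rewrite inE dO'.
  by rewrite (cards0_eq rest0) inE.
exists z, (D :\: Q), Q; split=> //.
- exact: subsetIr.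
- have : #|O'| <= #|D :\: Q| by apply/subset_leq_card/subsetP.
  apply: leq_trans; have := leq_imset_card g' O'; rewrite -ltnS.
  by move: TE cT'; rewrite zE cards1; clear; lia.
- by move=> d /DQO' dO'; rewrite (proj1 (zd d dO')) (farO' x d xM' dO').
- split=> //; first by apply: contraTneq w0S => ->; apply: MS.
    by have [] := zd z0 z0O'.
  by move=> y yS vy yx; apply: NE.
Qed.

(** The edge [xv] has a pendant shape too, and [x] is not its leaf. *)
Lemma private_nbr_swap : exists z P Q,
  [/\ P = (M :\ u :\ v) :\: Q, Q \subset M :\ u :\ v, #|Q| < #|P|,
      forall d, d \in P -> adj z d && ~~ adj x d
    & [/\ adj v z, z != u, ~~ adj u z &
          forall y, y \in S -> adj v y -> y != x -> y = z]].
Proof.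
have xv : adj x v by rewrite adjC.
have [T [M' [g' [pd'|pd']]]] := pendant_exists xv.
  exact: private_nbr_leaf pd'.
by case: (private_nbr_not_leaf pd').
Qed.

End Step.

(** Applying [private_nbr_swap] twice returns from [z] to [x]. The set [P] of
the first application sees [z] but not [x], that of the second sees [x] but not
[z], so each is contained in the exceptional set of the other, which is
smaller. *)
Lemma no_pendant S u v M g : ~ pendant S u v M g.
Proof.
move=> pd; have [x [vx xu nux]] := private_nbr (pd_adj pd).
have xS := pd_leaf pd vx xu.
have [z [P [Q [PE QD QP Pz [vz zu nuz Nv]]]]] := private_nbr_swap pd vx xu nux.
have [z' [P' [Q' [PE' QD' QP' Pz' [_ _ _ Nv']]]]] :=
  private_nbr_swap pd vz zu nuz.
have /card_gt0P[d0 d0P] : 0 < #|P| by apply: leq_trans QP.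
have xz : x != z by apply: contraTneq (Pz d0 d0P) => ->; case: (adj z d0).
have xz' : x = z' by apply: Nv'.
have PQ' : P \subset Q'.
  apply/subsetP => d dP; apply: contraT => dQ'; have /andP[zd _] := Pz d dP.
  have dP' : d \in P' by rewrite PE' inE dQ' /=; move: dP;
    rewrite PE inE => /andP[].
  by have := Pz' d dP'; rewrite zd andbF.
have P'Q : P' \subset Q.
  apply/subsetP => d dP'; apply: contraT => dQ; have /andP[xd _] := Pz' d dP'.
  have dP : d \in P by rewrite PE inE dQ /=; move: dP';
    rewrite PE' inE => /andP[].
  by have := Pz d dP; rewrite xz' xd andbF.
have := subset_leq_card PQ'; have := subset_leq_card P'Q.
by clear - QP QP'; lia.
Qed.

Lemma no_two_cut_edgeless u v : ~~ adj u v.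
Proof.
apply/negP => uv; have [S [M [g [pd|pd]]]] := pendant_exists uv;
  exact: no_pendant pd.
Qed.

End NoTwoCut.

Lemma minimally_tough_hamiltonian : hamiltonian G.
Proof.
have [[a [b [C cut]]]|nocut] := pselect (exists a b C, two_cut a b C).
  exact: hamiltonian_two_cut cut.
have no2 a b C : ~ two_cut a b C by move=> cut; apply: nocut; exists a, b, C.
have [u _] := @other_vertex [::] isT.
have [|v] := @other_vertex [:: u]; first by [].
rewrite inE => /has_nbr[s /andP[vs _]].
by have := no_two_cut_edgeless no2 v s; rewrite vs.
Qed.

End MinimallyTough.

(** * From toughness to colourings *)

Section FromToughness.

Lemma connect_const (H : sgraph) (K : eqType) (g : H -> K) :
  (forall x y, adj x y -> g x = g y) -> forall x y, connect adj x y ->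
    g x = g y.
Proof.
move=> gadj x y /connectP[p pth ->] {y}; elim: p x pth => //= z p IHp x.
by case/andP=> xz /IHp <-; apply: gadj.
Qed.

Lemma sgraph_connect_sym (H : sgraph) : connect_sym (@adj H).
Proof. by apply: sym_connect_sym; apply: adj_sym. Qed.

Lemma locally_const_num_components (G : sgraph) (K : finType) (S : {set G})
    (f : G -> K) :
  locally_const S f -> #|f @: ~: S| <= num_components (del_vertices S).
Proof.
move=> fS; set H := del_vertices S.
pose rs : {set H} := [set x | x \in roots adj].
have num : num_components H = #|rs|.
  by apply: eq_card => x; rewrite !inE andbT.
rewrite num; apply: leq_trans (leq_imset_card (fun x : H => f (val x)) rs).
apply/subset_leq_card/subsetP => _ /imsetP[x xS ->]; rewrite inE in xS.
set y : H := Sub x xS; apply/imsetP; exists (fingraph.root adj y).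
  by rewrite in_set; apply/roots_root/sgraph_connect_sym.
have fH (a b : H) : adj a b -> f (val a) = f (val b).
  exact: fS (valP a) (valP b).
exact: (connect_const fH (connect_root _ y)).
Qed.

Lemma locally_const_cut (G : sgraph) (K : finType) (S : {set G}) (f : G -> K) :
  locally_const S f -> 1 < #|f @: ~: S| -> vertex_cut S.
Proof.
move=> fS /card_gt1P[_ [_ [/imsetP[x xS ->] /imsetP[y yS ->] nfxy]]].
rewrite !inE in xS yS; apply/forallPn; exists (Sub x xS).
apply/forallPn; exists (Sub y yS); apply: contra nfxy => cxy; apply/eqP.
have fH (a b : del_vertices S) : adj a b -> f (val a) = f (val b).
  exact: fS (valP a) (valP b).
exact: (connect_const fH cxy).
Qed.

(** The colour of a vertex is the representative of its component. *)
Lemma cut_locally_const (G : sgraph) (S : {set G}) : vertex_cut S ->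
  exists f : G -> G, [/\ locally_const S f, 1 < #|f @: ~: S|
    & num_components (del_vertices S) <= #|f @: ~: S|].
Proof.
set H := del_vertices S => cutS.
pose f (x : G) : G :=
  if @insub _ _ {x : G | x \notin S} x is Some y
  then val (fingraph.root (@adj H) y) else x.
have fE x (xS : x \notin S) : f x = val (fingraph.root (@adj H) (Sub x xS)).
  by rewrite /f insubT.
exists f; split.
- move=> x y xS yS xy; rewrite !fE; congr val.
  apply/eqP; rewrite (root_connect (@sgraph_connect_sym H)).
  exact: connect1.
- have /forallPn[[x xS] /forallPn[[y yS] nxy]] := cutS.
  apply/card_gt1P; exists (f x), (f y); split; try by apply: imset_f;
    rewrite inE.
  rewrite !fE; apply: contra nxy => /eqP/val_inj/eqP.
  by rewrite (root_connect (@sgraph_connect_sym H)).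
(* roots are fixed by [f], so there are at least as many colours *)
- pose rs : {set H} := [set x | x \in roots adj].
  have -> : num_components H = #|rs|.
    by apply: eq_card => x; rewrite !inE andbT.
  rewrite -(card_imset _ (@val_inj _ _ {x : G | x \notin S})).
  apply/subset_leq_card/subsetP => _ /imsetP[[x xS] rx ->].
  rewrite in_set in rx.
  by apply/imsetP; exists x; rewrite ?inE // fE (eqP rx).
Qed.

Import Order.TTheory GRing.Theory Num.Theory.
Local Open Scope ring_scope.

Lemma tough_one_tough (R : realType) (G : sgraph) :
  tough (1 : R) G -> one_tough G.
Proof.
move=> tG K S f fS gt1; apply: leq_trans (locally_const_num_components fS) _.
have := tG S (locally_const_cut fS gt1).
by rewrite mul1r ler_nat.
Qed.

Lemma toughness_ge1 (R : realType) (G : sgraph) :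
  tough (1 : R) G -> (1%:E <= toughness G :> \bar R)%E.
Proof.
move=> tG; case: (boolP (is_complete G)) => [|ncG].
  by rewrite /toughness => ->; rewrite leey.
have [tau tauE] : exists tau : R, toughness G = tau%:E.
  by rewrite /toughness (negbTE ncG); eexists.
by rewrite tauE lee_fin; case/toughness_max: tauE => // _ _; apply.
Qed.

Lemma minimally_tough_noncomplete (R : realType) (t : R) (G : sgraph) :
  minimally_tough t G -> ~~ is_complete G.
Proof. by case=> _ tE _; apply/negP => cG; rewrite /toughness cG in tE. Qed.

Lemma minimally_tough_one_tough (R : realType) (G : sgraph) :
  minimally_tough (1 : R) G -> one_tough G.
Proof.
move=> minG; have ncG := minimally_tough_noncomplete minG.
by case: minG => _ /toughness_max[]// _ /tough_one_tough.
Qed.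

(** A cut of [G - uv] violating 1-toughness is not one of [G]; therefore [u]
and [v] avoid it and lie in different components. *)
Lemma minimally_tough_critical (R : realType) (G : sgraph) (u v : G) :
  minimally_tough (1 : R) G -> adj u v -> exists T f, critical_cut u v T f.
Proof.
move=> minG uv; have tG := minimally_tough_one_tough minG.
have {minG} [_ _ /(_ [set u; v])] := minG.
set e := [set u; v]; set G' := del_edge e => lt1.
have {lt1} /forallPn[T] : ~~ [forall T : {set G'}, vertex_cut T ==>
    (num_components (del_vertices T) <= #|T|)%N].
  apply/negP => /forallP tG'.
  have : (toughness G' < (1 : R)%:E)%E.
    by apply: lt1; apply/imsetP; exists (u, v); rewrite ?inE.
  rewrite ltNge toughness_ge1 // => T cutT.
  by rewrite mul1r ler_nat; apply: (implyP (tG' T)).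
rewrite negb_imply -ltnNge => /andP[cutT ltT].
have [f [fT gt1 /(leq_trans ltT) cardT]] := cut_locally_const cutT.
have fuv (x y : G) : x \notin T -> y \notin T -> adj x y ->
    ~~ ((x == u) && (y == v) || (x == v) && (y == u)) -> f x = f y.
  move=> xT yT xy nxy; apply: fT => //; rewrite /= /del_edge_adj xy /=.
  apply/negP => /eqP E; move/negP: nxy; apply.
  have neq : x != y by apply: contraTneq xy => ->; rewrite adj_irrefl.
  have := set21 x y; have := set22 x y; rewrite E !inE.
  by case/orP=> /eqP yE /orP[]/eqP xE; move: neq; rewrite xE yE !eqxx ?orbT.
have uvE : [&& u \notin T, v \notin T & f u != f v].
  rewrite -[X in is_true X]negbK; apply/negP => nuv.
  suff /tG/(_ gt1) : @locally_const G _ T f by rewrite leqNgt cardT.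
  move=> x y xT yT xy.
  case: (boolP ((x == u) && (y == v) || (x == v) && (y == u))); last exact: fuv.
  by case/orP=> /andP[/eqP xE /eqP yE]; move: nuv; rewrite -xE -yE xT yT /=
    negbK => /eqP.
by case/and3P: uvE => uT vT nfuv; exists T, f; split.
Qed.

End FromToughness.

(** In the conclusion [a b c d] is an induced path and [e] the isolated vertex;
they are automatically distinct. *)
Lemma H_free_K1_P4 (G : sgraph) :
  H_free (disjoint_union (complete_graph 1) (path_graph 4)) G ->
  forall a b c d e : G, adj a b -> adj b c -> adj c d ->
  ~~ adj a c -> ~~ adj a d -> ~~ adj b d ->
  ~~ adj a e -> ~~ adj b e -> ~~ adj c e -> ~~ adj d e -> False.
Proof.
move=> HfG a b c d e ab bc cd nac nad nbd nae nbe nce nde; apply: HfG.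
pose f (z : 'I_1 + 'I_4) : G :=
  nth e [:: e; a; b; c; d] (if z is inr i then i.+1 else 0).
have ne (x y z : G) : adj x y -> ~~ adj z y -> x != z.
  by move=> xy; apply: contraNneq => <-.
have us : uniq [:: e; a; b; c; d].
  have [ba cb dc] : [/\ adj b a, adj c b & adj d c] by split; rewrite adjC.
  rewrite /= !inE !negb_or (adj_neq ab) (adj_neq bc) (adj_neq cd).
  have nev (z w : G) : adj z w -> ~~ adj w e -> e != z.
    by move=> zw nwe; rewrite eq_sym (ne z w) // adjC.
  have ac : a != c by rewrite eq_sym (ne c d).
  have ad : a != d by rewrite (ne a b) // adjC.
  have bd : b != d by rewrite (ne b a) // adjC.
  by rewrite ac ad bd (nev a b) ?(nev b a) ?(nev c b) ?(nev d c).
exists f; split.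
- move=> x y /eqP; rewrite nth_uniq ?us //.
  + by case: x => [i|i]; case: y => [j|j] //=;
      rewrite ?ord1 // eqSS => /eqP/ord_inj ->.
  + by case: x => [i|i] //=; rewrite ltnS ltn_ord.
  + by case: y => [i|i] //=; rewrite ltnS ltn_ord.
- move=> [i|i] [j|j] //=; rewrite /f /=.
  + by rewrite !ord1 eqxx adj_irrefl.
  + by rewrite adjC; case: j => [[|[|[|[|j]]]] Hj] //=; apply/negbTE.
  + by case: i => [[|[|[|[|i]]]] Hi] //=; apply/negbTE.
  + rewrite /path_adj.
    case: i => [[|[|[|[|i]]]] Hi] //=; case: j => [[|[|[|[|j]]]] Hj] //=;
    rewrite ?adj_irrefl ?ab ?bc ?cd ?(negbTE nac) ?(negbTE nad) ?(negbTE nbd)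
      //;
    by rewrite adjC ?ab ?bc ?cd ?(negbTE nac) ?(negbTE nad) ?(negbTE nbd).
Qed.

(** Removing all but two non-adjacent vertices leaves two components. *)
Lemma one_tough_noncomplete_card (G : sgraph) :
  one_tough G -> ~~ is_complete G -> 3 < #|G|.
Proof.
move=> tG /forallPn[x /forallPn[y]]; rewrite negb_imply => /andP[xy nxy].
have S2 : #|~: [set x; y]| = #|G| - 2.
  by rewrite -(cardsC [set x; y]) cards2 xy addKn.
suff : 2 <= #|~: [set x; y]| by rewrite S2; case: #|G| => [|[|[|[|]]]].
apply: (@one_tough_seq _ _ _ id [:: x; y]) tG _ _ _ _ => //.
- move=> z w; rewrite !in_setC !negbK !inE => /orP[]/eqP-> /orP[]/eqP-> //.
    by rewrite (negbTE nxy).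
  by rewrite adjC (negbTE nxy).
- by move=> z; rewrite in_setC negbK !inE.
- by rewrite /= inE xy.
Qed.

Theorem corollary1p7 (R : realType) (G : sgraph) :
  (3 <= #|G|)%N ->
  minimally_tough (1 : R)%R G ->
  H_free (disjoint_union (complete_graph 1) (path_graph 4)) G ->
  hamiltonian G.
Proof.
move=> _ minG HfG; have tG := minimally_tough_one_tough minG.
have gt3 := one_tough_noncomplete_card tG (minimally_tough_noncomplete minG).
have critG (u v : G) := @minimally_tough_critical R G u v minG.
exact: minimally_tough_hamiltonian tG gt3 critG (H_free_K1_P4 HfG).
Qed.
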